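(* Let $L$ be a $d$-dimensional compound Poisson process with rate $r$ and the jumps being distributed like $(\varepsilon C)^{1/2}X$, where $X$ is a $d$-dimensional standard normal random variable, $C\in\mathbb{S}_d^+$ and $\varepsilon$ is a random variable in $\mathbb{R}^+$ with finite variance and independent of $X$. Then $$E([L,L]_1^{\mathfrak{d}})=rE(\varepsilon)C,$$ $$\mathrm{var}(\mathrm{vec}([L,L]_1^{\mathfrak{d}}))=rE(\varepsilon^2)\big(C\otimes C+K_d(C\otimes C)+\mathrm{vec}(C)\mathrm{vec}(C)^{\mathrm{T}}\big).$$
   Context: $M_d(\mathbb{R})$ is the set of real $d\times d$ matrices, $\mathbb{S}_d^+$ the set of symmetric positive semidefinite real $d\times d$ matrices, $\mathbb{R}^+=[0,\infty)$, and for a positive semidefinite matrix $(\cdot)^{1/2}$ is its positive semidefinite square root. $[L,L]^{\mathfrak{d}}_t=\sum_{0<s\le t}\Delta L_s(\Delta L_s)^{\mathrm{T}}$ is the discrete (discontinuous) part of the quadratic variation of $L$, $\Delta L_s$ being the jump at time $s$. $\mathrm{vec}$ stacks the columns of a $d\times d$ matrix below one another into a vector of $\mathbb{R}^{d^2}$; $\otimes$ is the Kronecker product; $\mathrm{var}$ of a random vector is its covariance matrix. $K_d\in M_{d^2}(\mathbb{R})$ is the commutation matrix, characterised by $K_d\,\mathrm{vec}(A)=\mathrm{vec}(A^{\mathrm{T}})$ for all $A\in M_d(\mathbb{R})$. *)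

(* Defs.v *)
From HB Require Import structures.
From mathcomp Require Import all_boot all_order all_algebra.
From mathcomp Require Import all_classical all_reals all_analysis.
From mathcomp.real_closed Require Export mxtens.

Set Implicit Arguments.
Unset Strict Implicit.
Unset Printing Implicit Defensive.
Import Order.TTheory GRing.Theory Num.Theory.
Import numFieldNormedType.Exports.
Local Open Scope classical_set_scope.
Local Open Scope ring_scope.

(* [vec] uses the same row-major pairing 'I_n * 'I_m -> 'I_(n * m) as the
   Kronecker product [tensmx] ( *t ) of [mxtens]: the entry of [vec A] at
   position j * m + i is A i j. *)
Definition vec (R : Type) m n (A : 'M[R]_(m, n)) : 'cV[R]_(n * m) :=
  \col_k A (mxtens_unindex k).2 (mxtens_unindex k).1.

Lemma vec_surj (R : nzRingType) m n (v : 'cV[R]_(n * m)) :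
  exists A : 'M[R]_(m, n), vec A = v.
Proof.
exists (\matrix_(i, j) v (mxtens_index (j, i)) 0).
by apply/colP => k; rewrite !mxE -surjective_pairing mxtens_unindexK.
Qed.

Definition commutation_mx (R : nzRingType) d : 'M[R]_(d * d) :=
  \matrix_(k, l)
    (mxtens_unindex k == ((mxtens_unindex l).2, (mxtens_unindex l).1))%:R.

Lemma commutation_mxP (R : nzRingType) d (K : 'M[R]_(d * d)) :
  (forall A : 'M[R]_d, K *m vec A = vec A^T) <-> K = commutation_mx R d.
Proof.
have commE (A : 'M[R]_d) : commutation_mx R d *m vec A = vec A^T.
  apply/colP => k; case: (mxtens_indexP k) => i j.
  rewrite !mxE mxtens_indexK (bigD1 (mxtens_index (j, i)))//= big1 ?addr0.
    by rewrite !mxE !mxtens_indexK eqxx mul1r.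
  move=> l; case: (mxtens_indexP l) => p q lk; rewrite !mxE !mxtens_indexK.
  rewrite (_ : _ == _ = false) ?mul0r//.
  by apply: contraNF lk => /eqP[-> ->].
split=> [KE|-> //]; apply/matrixP => i j.
have [A Aj] := vec_surj (delta_mx j 0 : 'cV[R]_(d * d)).
have := congr1 (fun v : 'cV[R]_(d * d) => v i 0) (KE A).
by rewrite -commE Aj -!colE !mxE.
Qed.

Section psd.
Variables (R : realType) (d : nat).

Definition psdmx (A : 'M[R]_d) : Prop :=
  A^T = A /\ forall x : 'cV[R]_d, 0 <= (x^T *m A *m x) 0 0.

(* For positive semidefinite A, the set below is a singleton. *)
Definition psdsqrtmx (A : 'M[R]_d) : 'M[R]_d :=
  xget 0 [set B | psdmx B /\ B *m B = A].

End psd.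

(* Product (Borel) sigma-algebra on matrices, generated by the entries. *)
Definition matrix_display : measure_display -> measure_display.
Proof. exact. Qed.

Section measurable_matrix.
Context {disp} {T : measurableType disp} (m n : nat).

Definition measurable_matrix : set (set 'M[T]_(m, n)) :=
  <<s \bigcup_(ij : 'I_m * 'I_n) preimage_set_system [set: 'M[T]_(m, n)]
        (fun A => A ij.1 ij.2) measurable >>.

Let measurable_matrix0 : measurable_matrix set0.
Proof. exact: sigma_algebra0. Qed.

Let measurable_matrixC A : measurable_matrix A -> measurable_matrix (~` A).
Proof. exact: sigma_algebraC. Qed.

Let measurable_matrix_bigcup (F : (set 'M[T]_(m, n))^nat) :
  (forall i, measurable_matrix (F i)) -> measurable_matrix (\bigcup_i (F i)).
Proof. exact: sigma_algebra_bigcup. Qed.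

HB.instance Definition _ := @isMeasurable.Build (matrix_display disp)
  'M[T]_(m, n) measurable_matrix measurable_matrix0 measurable_matrixC
  measurable_matrix_bigcup.

End measurable_matrix.

Section independence.
Context {disp} {T : measurableType disp} {R : realType} (P : probability T R).

Definition independent_systems (F G : set (set T)) : Prop :=
  forall A B, F A -> G B -> (P (A `&` B) = P A * P B)%E.

Definition mutually_independent_systems (I : eqType) (F : I -> set (set T)) :=
  forall (s : seq I) (A : I -> set T), uniq s ->
    (forall i, i \in s -> F i (A i)) ->
    (P (\bigcap_(i in [set` s]) A i) = \prod_(i <- s) P (A i))%E.

End independence.

(* sigma-algebra generated by the family (X i) for i in D *)
Definition sigma_family {disp} {T : Type} {T' : measurableType disp} {I : Type}
    (D : set I) (X : I -> T -> T') : set (set T) :=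
  <<s \bigcup_(i in D) preimage_set_system [set: T] (X i) measurable >>.

Section processes.
Context {disp} {T : measurableType disp} {R : realType} (P : probability T R).

Definition cadlag (f : R -> R) : Prop := forall t, 0 <= t ->
  f x @[x --> t^'+] --> f t /\ (0 < t -> cvg (f x @[x --> t^'-])).

(* Processes are indexed by all of R, but only times t >= 0 are constrained.
   Increments are taken in R since subtraction on nat is truncated. *)
Definition poisson_process (r : R) (N : R -> {RV P >-> nat}) : Prop :=
  [/\ {ae P, forall w, N 0 w = 0%N},
      forall t : nat -> R, 0 <= t 0%N -> nondecreasing_seq t ->
        mutually_independent_systems P (fun k => g_sigma_algebra_preimage
          (fun w => (N (t k.+1) w)%:R - (N (t k) w)%:R : R)),
      forall s t k, 0 <= s -> s < t ->
        P [set w | (N t w)%:R - (N s w)%:R = k%:R :> R]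
          = (poisson_pmf (r * (t - s)) k)%:E
    & {ae P, forall w, cadlag (fun t => (N t w)%:R)}].

(* Compound Poisson process with rate r and jump distribution mu. *)
Definition compound_poisson_process d (r : R) (mu : set 'cV[R]_d -> \bar R)
    (L : R -> {RV P >-> 'cV[R]_d}) : Prop :=
  exists (N : R -> {RV P >-> nat}) (Y : nat -> {RV P >-> 'cV[R]_d}),
  [/\ poisson_process r N,
      forall k A, measurable A -> distribution P (Y k) A = mu A,
      mutually_independent_systems P (fun k => g_sigma_algebra_preimage (Y k)),
      independent_systems P (sigma_family [set t | 0 <= t] N)
                            (sigma_family [set: nat] Y)
    & {ae P, forall w, forall t, 0 <= t -> L t w = \sum_(k < N t w) Y k w}].

Definition standard_normal_vector d (X : {RV P >-> 'cV[R]_d}) : Prop :=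
  mutually_independent_systems P
    (fun i : 'I_d => g_sigma_algebra_preimage (fun w => X w i 0)) /\
  forall (i : 'I_d) (A : set R), measurable A ->
    P ((fun w => X w i 0) @^-1` A) = normal_prob 0 1 A.

Definition expectation_mx m n (X : T -> 'M[R]_(m, n)) : 'M[\bar R]_(m, n) :=
  \matrix_(i, j) 'E_P[fun w => X w i j]%E.

Definition covariance_mx n (X : T -> 'cV[R]_n) : 'M[\bar R]_n :=
  \matrix_(i, j) covariance P (fun w => X w i 0) (fun w => X w j 0).

End processes.

Section discrete_quadratic_variation.
Variables (R : realType) (d : nat).

Definition jump (f : R -> 'cV[R]_d) (s : R) : 'cV[R]_d :=
  f s - \col_i lim (f x i 0 @[x --> s^'-]).

(* Sum of a real family over a set, meaningful when it is absolutely summable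
   ([\esum] is only intended for nonnegative terms). *)
Definition abs_sum (D : set R) (u : R -> R) : R :=
  fine (\esum_(s in D) (EFin \o u)^\+ s - \esum_(s in D) (EFin \o u)^\- s)%E.

Definition discrete_qv (f : R -> 'cV[R]_d) (t : R) : 'M[R]_d :=
  \matrix_(i, j)
    abs_sum `]0, t]%classic (fun s => (jump f s *m (jump f s)^T) i j).

End discrete_quadratic_variation.

(* Main.v *)
Require Import Defs.
From HB Require Import structures.
From mathcomp Require Import all_boot all_order all_algebra.
From mathcomp Require Import all_classical all_reals all_analysis.
From mathcomp Require Import complex measurable_realfun ring lra.

Set Implicit Arguments.
Unset Strict Implicit.
Unset Printing Implicit Defensive.
Import Order.TTheory GRing.Theory Num.Theory.
Import numFieldNormedType.Exports.
Local Open Scope classical_set_scope.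
Local Open Scope ring_scope.

(** Almost surely a Poisson process [N] starts at 0, is nondecreasing and right
    continuous, and has jumps of size 1 only.  The path of [L] at such a point
    is the step path [t |-> \sum_(k < N t) Y k], whose jumps on ]0, 1] are
    [Y 0], ..., [Y (N 1 - 1)], each of them occurring once.  Hence
    [L,L]^d_1 is almost surely [\sum_(k < N 1) Y k (Y k)^T]
    ([discrete_qv_compound_poisson_ae]), and everything else is a computation
    of moments of random sums.

    Let [a k] and [b k] be two entries of [Y k (Y k)^T], with means [alpha] and
    [beta], and let [gamma] be the mean of [a k * b k].  Given [N 1 = n], the
    sum of the [a k] has mean [alpha * n], and the product of the sums of the
    [a k] and of the [b k] has mean [gamma * n + alpha * beta * n (n - 1)],
    because distinct jumps are independent.  The first two factorial moments
    of the Poisson law are [r] and [r ^ 2], so that the mean of the sum is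
    [alpha * r], the mean of the product is
    [gamma * r + alpha * beta * r ^ 2], and the covariance is [gamma * r]
    ([has_mean_compound_cov]).

    It remains to compute [alpha] and [gamma].  The positive semidefinite square
    root is unique, so [(e C)^(1/2) = sqrt e * C^(1/2)], and a jump is
    distributed like [sqrt eps * W] with [W = C^(1/2) X] Gaussian with
    covariance [C].  The entries of [W W^T] have mean [C i j], and Isserlis'
    formula gives [C i j * C k l + C i k * C j l + C i l * C j k] for the mean of
    [W i * W j * W k * W l] ([has_mean_linear4]).  By independence of [eps] and
    [X] these means are multiplied by the first, respectively the second moment
    of [eps].  In the vectorised form the three products are the entries of
    [vec C (vec C)^T], [C (x) C] and [K (C (x) C)].

    Two points need care.  The discrete quadratic variation is only almost
    everywhere equal to a measurable function; the integral, being a lower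
    integral on nonnegative functions, nevertheless gives the expected value
    ([ae_eq_integral_nonmeasurable]).  And independence enters through a single
    principle ([integral_density]): a nonnegative [g] that integrates to
    [k * P E] on each event [E] of the form [f \in B] satisfies
    [E (g * f) = k * E f]. *)

(** * The positive semidefinite square root *)

Section psd_square_root.
Variable R : realType.

Lemma interpolation (F : fieldType) (s : seq F) (f : F -> F) :
  exists p : {poly F}, forall x, x \in s -> p.[x] = f x.
Proof.
elim: s => [|a s [p pf]]; first by exists 0.
have [sa|sa] := boolP (a \in s).
  by exists p => x; rewrite inE => /predU1P[->|]; exact: pf.
pose w := \prod_(b <- s) ('X - b%:P).
have wa : w.[a] != 0 by rewrite -[_ == _]/(root w a) root_prod_XsubC.
exists (p + ((f a - p.[a]) / w.[a]) *: w) => x; rewrite inE !hornerE.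
move=> /predU1P[->|xs]; first by rewrite divfK// addrC subrK.
suff /eqP -> : root w x by rewrite mulr0 addr0 pf.
by rewrite root_prod_XsubC.
Qed.

Lemma sqr_col_eq0 d (x : 'cV[R]_d) : (x^T *m x) 0 0 = 0 -> x = 0.
Proof.
rewrite mxE => /eqP; rewrite psumr_eq0; last first.
  by move=> i _; rewrite mxE -expr2 sqr_ge0.
move=> /allP x0; apply/colP => i; have := x0 i (mem_index_enum _).
by rewrite !mxE mulf_eq0 orbb => /eqP.
Qed.

(** An eigenvector [v] gives [0 <= v A v^T = a * v v^T]. *)
Lemma psdmx_eigenvalue_ge0 d (A : 'M[R]_d) (a : R) :
  psdmx A -> eigenvalue A a -> 0 <= a.
Proof.
move=> [_ A0] /eigenvalueP[v vA v0]; rewrite leNgt; apply/negP => a0.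
have := A0 v^T; rewrite trmxK vA -scalemxAl mxE nmulr_rge0// => vv.
move/eqP: v0; apply; apply: trmx_inj; rewrite trmx0; apply: sqr_col_eq0.
rewrite trmxK; apply/eqP; rewrite eq_le vv mxE sumr_ge0// => i _.
by rewrite mxE -expr2 sqr_ge0.
Qed.

Lemma sym_horner_mx d (A : 'M[R]_d.+1) p :
  A^T = A -> (horner_mx A p)^T = horner_mx A p.
Proof.
move=> As; elim/poly_ind: p => [|p c IH]; first by rewrite rmorph0 trmx0.
rewrite rmorphD rmorphM/= horner_mx_X horner_mx_C linearD/= tr_scalar_mx.
by rewrite trmx_mul As IH; congr (_ + _); apply: comm_mx_horner.
Qed.

(** Diagonalise [A] over the complex numbers and let [q] be a real polynomial that
    takes at each eigenvalue [a] of [A] the value of its fourth root.  Then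
    [G = q(A)] is real and symmetric, so [G ^ 2 = G^T G] is positive
    semidefinite, and [G ^ 4 = A].  Producing the root as a polynomial in [A]
    keeps it real and makes it commute with whatever commutes with [A]. *)
Lemma psdmx_horner_sqrt d (A : 'M[R]_d.+1) : psdmx A ->
  exists p : {poly R}, psdmx (horner_mx A p) /\
    horner_mx A p *m horner_mx A p = A.
Proof.
move=> Apsd; have [As _] := Apsd.
pose Ac := map_mx (real_complex R) A.
have Acreal : Ac \is a mxOver Num.real.
  by apply/mxOverP => i j; rewrite mxE; apply/complex_realP; exists (A i j).
have Acsym : Ac \is symmetricmx.
  apply/is_hermitianmxP; rewrite expr0 scale1r map_mx_id//.
  by apply/matrixP => i j; rewrite !mxE -[in LHS]As mxE.
have Acherm := realsym_hermsym Acsym Acreal.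
have /orthomx_spectralP := hermitian_normalmx Acherm.
set U := spectralmx Ac; set D := spectral_diag Ac => AcE.
have Uu : U \in unitmx by exact: spectral_unit.
have Dreal i : exists2 a, D 0 i = a%:C%C & eigenvalue A a.
  have /mxOverP/(_ 0 i)/complex_realP[a Da] :=
    hermitian_spectral_diag_real Acherm.
  exists a => //; rewrite eigenvalue_root_char -(fmorph_root (real_complex R)).
  rewrite map_char_poly -/Ac -eigenvalue_root_char.
  apply/eigenvalueP; exists (row i U).
    rewrite [X in _ *m X]AcE -row_mul !mulmxA mulmxV// mul1mx.
    by apply/rowP => j; rewrite mul_diag_mx !mxE Da.
  (* a row of an invertible matrix is nonzero *)
  by apply: contraTneq Uu => Ui0; rewrite -row_free_unit -kermx_eq0;
    apply/rowV0P => /(_ (delta_mx 0 i)); rewrite sub_kermx -rowE Ui0 eqxx =>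
      /(_ isT)/matrixP/(_ 0 i)/eqP; rewrite !mxE !eqxx oner_eq0.
have [q qE] := interpolation [seq complex.Re (D 0 i) | i <- enum 'I_d.+1]
  (fun x => Num.sqrt (Num.sqrt x)).
exists (q ^+ 2); rewrite rmorphXn/= expr2.
set G := horner_mx A q; have Gs : G^T = G by exact: sym_horner_mx.
split.
  split=> [|x]; first by rewrite trmx_mul Gs.
  rewrite -{1}Gs mulmxA -trmx_mul -mulmxA mxE sumr_ge0// => i _.
  by rewrite mxE -expr2 sqr_ge0.
have -> : G * G *m (G * G) = horner_mx A (q ^+ 4).
  by rewrite rmorphXn/= -/G (exprM _ 2 2) !expr2.
apply: (@map_mx_inj _ _ (real_complex R)).
rewrite map_horner_mx -/Ac [in LHS]AcE horner_mx_uconjC//.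
rewrite horner_mx_diag [in RHS]AcE; congr (_ *m diag_mx _ *m _).
apply/rowP => i; rewrite !mxE.
have [a Da eiga] := Dreal i; rewrite Da horner_map.
rewrite horner_exp; congr (_%:C)%C.
rewrite qE; last first.
  by apply/mapP; exists i; rewrite ?mem_enum// Da.
have a0 := psdmx_eigenvalue_ge0 Apsd eiga.
by rewrite (exprM _ 2 2) !sqr_sqrtr ?sqrtr_ge0.
Qed.

Lemma psdmx_sqrt_commute d (A : 'M[R]_d) : psdmx A ->
  exists B, [/\ psdmx B, B *m B = A &
    forall M, A *m M = M *m A -> B *m M = M *m B].
Proof.
case: d A => [|d] A Apsd; last first.
  have [p [Bpsd BB]] := psdmx_horner_sqrt Apsd.
  by exists (horner_mx A p); split=> // M AM; exact: comm_horner_mx.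
by exists A; split=> //; apply/matrixP => -[].
Qed.

(** With [S = B B] and [B] symmetric, the form at [y] is the squared norm of
    [B y]. *)
Lemma psdmx_form_eq0 d (S : 'M[R]_d) (y : 'cV[R]_d) :
  psdmx S -> (y^T *m S *m y) 0 0 = 0 -> S *m y = 0.
Proof.
move=> /psdmx_sqrt_commute[B [[Bs _] BB _]]; rewrite -BB => y0.
rewrite -mulmxA (_ : B *m y = 0) ?mulmx0//; apply: sqr_col_eq0.
by rewrite trmx_mul Bs !mulmxA; rewrite mulmxA in y0.
Qed.

(** A root [M] commutes with [A], hence with the polynomial root [B], so that
    [(M + B) (M - B) = 0].  For [y = (M - B) x] the sum of the two nonnegative
    numbers [y^T M y] and [y^T B y] vanishes; thus [M y = B y = 0], and then
    [|y| ^ 2 = x^T (M - B) y = 0]. *)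
Lemma psdmx_sqrt_unique d (A S S' : 'M[R]_d) : psdmx A ->
  psdmx S -> S *m S = A -> psdmx S' -> S' *m S' = A -> S = S'.
Proof.
move=> /psdmx_sqrt_commute[B [Bpsd BB Bcomm]].
suff uniq_B M : psdmx M -> M *m M = A -> M = B.
  by move=> Sp SS S'p S'S'; rewrite (uniq_B S)// (uniq_B S').
move=> Mpsd MM.
have BM : B *m M = M *m B by apply: Bcomm; rewrite -MM mulmxA.
pose D := M - B.
have Ds : D^T = D by rewrite linearB/= (proj1 Mpsd) (proj1 Bpsd).
have SD : (M + B) *m D = 0.
  by rewrite mulmxBr !mulmxDl MM BB BM [X in X - _]addrC subrr.
have D0 (x : 'cV[R]_d) : D *m x = 0.
  set y := D *m x.
  have : (y^T *m M *m y) 0 0 + (y^T *m B *m y) 0 0 = 0.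
    have : y^T *m (M + B) *m y = 0.
      by rewrite -mulmxA [_ *m y]mulmxA SD mul0mx mulmx0.
    by move/(congr1 (fun N : 'M[R]_1 => N 0 0)); rewrite mulmxDr mulmxDl !mxE.
  move/eqP; rewrite paddr_eq0; [|exact: (proj2 Mpsd)|exact: (proj2 Bpsd)].
  move=> /andP[/eqP/(psdmx_form_eq0 Mpsd) My /eqP/(psdmx_form_eq0 Bpsd) By].
  apply: sqr_col_eq0; rewrite {1}/y trmx_mul Ds -mulmxA.
  by rewrite [D *m y]mulmxBl My By subrr mulmx0 mxE.
apply/eqP; rewrite -subr_eq0; apply/eqP/matrixP => i j.
by have := D0 (delta_mx j 0); rewrite -colE => /matrixP/(_ i 0); rewrite !mxE.
Qed.

Lemma psdsqrtmxP d (A : 'M[R]_d) : psdmx A ->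
  psdmx (psdsqrtmx A) /\ psdsqrtmx A *m psdsqrtmx A = A.
Proof.
move=> /psdmx_sqrt_commute[B [Bpsd BB _]].
by rewrite /psdsqrtmx; case: xgetP => [M -> //|/(_ B)]; case.
Qed.

Lemma psdmxZ d (A : 'M[R]_d) e : 0 <= e -> psdmx A -> psdmx (e *: A).
Proof.
move=> e0 [As A0]; split=> [|x]; first by rewrite linearZ/= As.
by rewrite -scalemxAr -scalemxAl mxE mulr_ge0.
Qed.

(** Uniqueness gives the chosen root of [e *: A] in closed form, which makes it a
    measurable function of [e]. *)
Lemma psdsqrtmxZ d (A : 'M[R]_d) e : 0 <= e -> psdmx A ->
  psdsqrtmx (e *: A) = Num.sqrt e *: psdsqrtmx A.
Proof.
move=> e0 Apsd; have [Bpsd BB] := psdsqrtmxP Apsd.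
have eApsd := psdmxZ e0 Apsd; have [Cpsd CC] := psdsqrtmxP eApsd.
apply: (psdmx_sqrt_unique eApsd) => //; first exact/psdmxZ.
by rewrite -scalemxAr -scalemxAl scalerA -expr2 sqr_sqrtr// BB.
Qed.

End psd_square_root.

(** * Functions with a prescribed mean *)

Section density.
Local Open Scope ereal_scope.
Context {d} {T : measurableType d} {R : realType}.
Variables mu nu : {measure set T -> \bar R}.
Implicit Types (f g : T -> R).

Import HBNNSimple.

(** By monotone convergence it suffices to replace [f] by [h \o f] with [h] simple,
    and then the claim is the hypothesis, summed over the values of [h].  For
    [mu = nu] the hypothesis says that [g] has the constant conditional mean [k]
    given [f], which is how independence is used; for [k = 1], that [g] is a
    density of [nu] with respect to [mu] on the events generated by [f]. *)
Lemma integral_density f g k :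
  measurable_fun setT f -> measurable_fun setT g ->
  (forall x, 0 <= f x)%R -> (forall x, 0 <= g x)%R ->
  (forall B, measurable B ->
    \int[mu]_x (g x * \1_(f @^-1` B) x)%:E = k%:E * nu (f @^-1` B)) ->
  \int[mu]_x (g x * f x)%:E = k%:E * \int[nu]_x (f x)%:E.
Proof.
move=> mf mg f0 g0 gB.
have mfB B : measurable B -> measurable (f @^-1` B).
  by move=> mB; rewrite -[X in measurable X]setTI; exact: mf.
(* [q] is nonnegative on all of [R] and agrees with [EFin] on the values of
   [f], so that it can be approximated by simple functions from below *)
pose q := fun y : R => (Num.max y 0)%:E.
have mq : measurable_fun setT q.
  by apply/measurable_EFinP; exact: measurable_maxr.
have q0 (y : R) : setT y -> 0 <= q y by rewrite lee_fin le_max lexx orbT.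
pose h := nnsfun_approx measurableT mq.
have hf x : (h n (f x))%:E @[n --> \oo] --> (f x)%:E.
  have := @cvg_nnsfun_approx _ _ _ _ measurableT _ mq q0 (f x) Logic.I.
  by rewrite /q max_l.
have mhf n : measurable_fun setT (h n \o f) by exact: measurableT_comp.
have hnd y m n : (m <= n)%N -> (h m y <= h n y)%R.
  by move=> mn; exact/lefP/nd_nnsfun_approx.
have cf : \int[nu]_x (h n (f x))%:E @[n --> \oo] --> \int[nu]_x (f x)%:E.
  rewrite [X in _ --> X](_ : _ = \int[nu]_x limn (fun n => (h n (f x))%:E)).
    apply: cvg_monotone_convergence => //.
    - by move=> n; apply/measurable_EFinP; exact: mhf.
    - by move=> n x _; rewrite lee_fin.
    - by move=> x _ m n mn; rewrite lee_fin hnd.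
  by apply: eq_integral => x _; apply/esym/cvg_lim => //; exact: hf.
have cgf : \int[mu]_x (g x * h n (f x))%:E @[n --> \oo] -->
           \int[mu]_x (g x * f x)%:E.
  rewrite [X in _ --> X](_ : _ =
      \int[mu]_x limn (fun n => (g x * h n (f x))%:E)).
    apply: cvg_monotone_convergence => //.
    - by move=> n; apply/measurable_EFinP; apply: measurable_funM => //; exact: mhf.
    - by move=> n x _; rewrite lee_fin mulr_ge0.
    - by move=> x _ m n mn; rewrite lee_fin ler_wpM2l// hnd.
  apply: eq_integral => x _; apply/esym/cvg_lim => //.
  under eq_fun do rewrite EFinM.
  by rewrite EFinM; apply: cvgeZl => //; exact: hf.
suff E n : \int[mu]_x (g x * h n (f x))%:E = k%:E * \int[nu]_x (h n (f x))%:E.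
  rewrite -(cvg_lim _ cgf)//; apply/cvg_lim => //.
  by under eq_fun do rewrite E; exact: cvgeZl.
have fin_h : finite_set (range (h n)) by [].
have hE x : (h n (f x))%:E = \sum_(y \in range (h n))
    (y%:E * (\1_(f @^-1` (h n @^-1` [set y])) x)%:E).
  by rewrite fimfunE -fsumEFin//.
have mB y : measurable (f @^-1` (h n @^-1` [set y])).
  by apply: mfB; exact: measurable_funPTI.
have h0 y x : 0 <= y%:E * (\1_(f @^-1` (h n @^-1` [set y])) x)%:E.
  exact: (nnfun_muleindic_ge0 (h n) y (f x)).
have mind y : measurable_fun setT
    (fun x => y%:E * (\1_(f @^-1` (h n @^-1` [set y])) x)%:E).
  by apply/measurable_EFinP; apply: measurable_funM => //; exact: measurable_indic.
have -> : \int[nu]_x (h n (f x))%:E =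
    \sum_(y \in range (h n)) y%:E * nu (f @^-1` (h n @^-1` [set y])).
  under eq_integral do rewrite hE.
  rewrite ge0_integral_fsum//; apply: eq_fsbigr => y /set_mem[z _ <-].
  rewrite ge0_integralZl//; last 2 first.
  - exact/measurable_EFinP/measurable_indic.
  - by rewrite lee_fin.
  by rewrite integral_indic ?setIT.
rewrite ge0_mule_fsumr; last first.
  move=> y; apply: (mulemu_ge0 (fun y => f @^-1` (h n @^-1` [set y]))) => y0.
  by rewrite preimage_nnfun0// preimage_set0.
transitivity (\int[mu]_x \sum_(y \in range (h n))
    ((g x)%:E * (y%:E * (\1_(f @^-1` (h n @^-1` [set y])) x)%:E))).
  by apply: eq_integral => x _; rewrite EFinM hE ge0_mule_fsumr.
rewrite ge0_integral_fsum//; last 2 first.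
- move=> y; apply: emeasurable_funM; last exact: mind.
  exact/measurable_EFinP.
- by move=> y x _; apply: mule_ge0; [rewrite lee_fin|exact: h0].
apply: eq_fsbigr => y /set_mem[z _ yE].
transitivity (\int[mu]_x (y%:E *
    (g x * \1_(f @^-1` (h n @^-1` [set y])) x)%:E)).
  by apply: eq_integral => x _; rewrite muleCA EFinM.
rewrite ge0_integralZl//; last 3 first.
- by apply/measurable_EFinP; apply: measurable_funM => //; exact: measurable_indic.
- by move=> x _; rewrite lee_fin mulr_ge0.
- by rewrite lee_fin -yE.
by rewrite gB; [rewrite muleCA|exact: measurable_funPTI].
Qed.

End density.

Section mean.
Local Open Scope ereal_scope.
Context {d} {T : measurableType d} {R : realType} (P : probability T R).
Implicit Types (f g : T -> R) (c : R).

(** A relation rather than an equation on expectations, so that integrability and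
    value are propagated together. *)
Definition has_mean f c :=
  P.-integrable setT (EFin \o f) /\ \int[P]_x (f x)%:E = c%:E.

Lemma has_mean_meas f c : has_mean f c -> measurable_fun setT f.
Proof. by move=> [/measurable_int/measurable_EFinP]. Qed.

Lemma has_mean_fine f :
  P.-integrable setT (EFin \o f) -> has_mean f (fine 'E_P[f]).
Proof.
by move=> fi; split=> //; rewrite unlock fineK//; exact: integrable_fin_num.
Qed.

Lemma has_mean_ge0 f c : measurable_fun setT f -> (forall x, 0 <= f x)%R ->
  \int[P]_x (f x)%:E = c%:E -> has_mean f c.
Proof.
move=> mf f0 fc; split=> //; apply/integrableP; split; first exact/measurable_EFinP.
under eq_integral do rewrite /= ger0_norm//.
by rewrite fc ltry.
Qed.

Lemma has_mean_cst c : has_mean (cst c) c.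
Proof.
split; first exact: finite_measure_integrable_cst.
by have := expectation_cst P c; rewrite unlock.
Qed.

Lemma has_meanD f g a b :
  has_mean f a -> has_mean g b -> has_mean (f \+ g)%R (a + b).
Proof.
move=> [fi fa] [gi gb]; split.
  by rewrite (_ : EFin \o _ = (EFin \o f) \+ (EFin \o g))//; exact: integrableD.
by rewrite EFinD -fa -gb -integralD_EFin.
Qed.

Lemma has_meanZ f a k : has_mean f a -> has_mean (fun x => k * f x)%R (k * a).
Proof.
move=> [fi fa]; split.
  rewrite (_ : EFin \o _ = fun x => k%:E * (EFin \o f) x)//.
  exact: integrableZl.
by under eq_integral do rewrite EFinM; rewrite integralZl// fa.
Qed.

Lemma has_mean_sum (I : Type) (s : seq I) (p : pred I) (F : I -> T -> R) (c : I -> R) :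
  (forall i, p i -> has_mean (F i) (c i)) ->
  has_mean (fun x => \sum_(i <- s | p i) F i x)%R (\sum_(i <- s | p i) c i).
Proof.
move=> Fc; elim: s => [|i s IH].
  rewrite big_nil; under eq_fun do rewrite big_nil; exact: has_mean_cst.
rewrite big_cons; under eq_fun do rewrite big_cons.
by case: ifPn => // pi; apply: has_meanD => //; exact: Fc.
Qed.

Lemma has_mean_norm f c : has_mean f c ->
  has_mean (fun x => `|f x|)%R (fine 'E_P[fun x => `|f x|%R]).
Proof.
move=> [fi _]; apply: has_mean_fine.
exact: integrable_norm.
Qed.

Lemma has_mean_uniq f a b : has_mean f a -> has_mean f b -> a = b.
Proof. by move=> [_ +] [_ +] => -> []. Qed.

Lemma has_mean_indic (A : set T) :
  measurable A -> has_mean \1_A (fine (P A)).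
Proof.
move=> mA; apply: has_mean_ge0 => //; rewrite integral_indic// setIT fineK//.
exact: fin_num_measure.
Qed.

Definition adapted (G : set (set T)) f :=
  forall B, measurable B -> G (f @^-1` B).

Lemma adapted_comp (G : set (set T)) f (u : R -> R) :
  measurable_fun setT u -> adapted G f -> adapted G (u \o f).
Proof.
move=> mu Gf B mB; rewrite comp_preimage; apply: Gf.
by rewrite -[X in measurable X]setTI; exact: mu.
Qed.

End mean.

(** * Products of independent functions *)

Section product_rule.
Context {d} {T : measurableType d} {R : realType} (P : probability T R).
Variables (I : choiceType) (F : I -> set (set T)).
Hypothesis mF : forall i A, F i A -> measurable A.
Hypothesis indepF : mutually_independent_systems P F.
Implicit Types (f : I -> T -> R) (m : I -> R) (s : seq I).

Let mcap s (A : I -> set T) : (forall i, i \in s -> F i (A i)) ->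
  measurable (\bigcap_(i in [set` s]) A i).
Proof.
move=> FA; apply: fin_bigcap_measurable => [|i si]; first exact: finite_seq.
by apply: (@mF i); exact: FA.
Qed.

(** Independence is the case where [s1] is empty.  The functions are introduced
    one by one: if the claim holds with an arbitrary event of [F j] among the
    events of [s2], then [integral_density] lets the function [f j] replace that
    event. *)
Let has_mean_prod_indic s1 s2 f m (A : I -> set T) : uniq (s1 ++ s2) ->
  (forall i, i \in s1 -> [/\ has_mean P (f i) (m i), adapted (F i) (f i)
                           & forall x, 0 <= f i x]) ->
  (forall i, i \in s2 -> F i (A i)) ->
  has_mean P
    (fun x => (\prod_(i <- s1) f i x) * \1_(\bigcap_(i in [set` s2]) A i) x)
    (\prod_(i <- s1) m i * fine (P (\bigcap_(i in [set` s2]) A i))).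
Proof.
elim: s1 s2 A => [|j s1 IH] s2 A.
  move=> _ _ FA; rewrite big_nil mul1r.
  under eq_fun do rewrite big_nil mul1r.
  by apply: has_mean_indic; exact: mcap.
rewrite cat_cons cons_uniq mem_cat negb_or => /andP[/andP[js1 js2] us12] fm FA.
have [fj aj fj0] := fm j (mem_head _ _).
have fms1 i : i \in s1 -> [/\ has_mean P (f i) (m i), adapted (F i) (f i)
                           & forall x, 0 <= f i x].
  by move=> si; apply: fm; rewrite inE si orbT.
set E := \bigcap_(i in _) A i.
pose g x := (\prod_(i <- s1) f i x) * \1_E x.
pose k := \prod_(i <- s1) m i * fine (P E).
have gk : has_mean P g k by exact: IH.
have g0 x : 0 <= g x.
  rewrite mulr_ge0// big_seq prodr_ge0// => i si.
  by have [_ _ ->] := fms1 _ si.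
rewrite (_ : (fun x => _) = fun x => g x * f j x); last first.
  by apply/funext => x; rewrite big_cons /g -mulrA mulrC.
rewrite big_cons (_ : _ * _ = k * m j); last by rewrite /k -mulrA mulrC.
apply: has_mean_ge0.
- by apply: measurable_funM; [exact: has_mean_meas gk|exact: has_mean_meas fj].
- by move=> x; rewrite mulr_ge0.
rewrite (@integral_density _ _ _ P P (f j) g k)//.
- by rewrite fj.2 EFinM.
- exact: has_mean_meas fj.
- exact: has_mean_meas gk.
move=> B mB.
pose A' i := if i == j then f j @^-1` B else A i.
have FA' i : i \in j :: s2 -> F i (A' i).
  rewrite inE /A'; case: eqVneq => [-> _|_ /= si]; last exact: FA.
  exact: aj.
have capA' : \bigcap_(i in [set` j :: s2]) A' i = f j @^-1` B `&` E.
  rewrite /E !bigcap_seq big_cons /A' eqxx; congr (_ `&` _).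
  apply: eq_big_seq => i si; case: eqVneq => // ij.
  by move: js2; rewrite -ij si.
have us : uniq (s1 ++ j :: s2).
  by rewrite (uniq_catCA s1 [:: j] s2)/= mem_cat negb_or js1 js2.
have [_] := IH (j :: s2) A' us fms1 FA'; rewrite -/(g _) capA'.
have PfE : P (f j @^-1` B `&` E) = (P (f j @^-1` B) * P E)%E.
  have us2 : uniq (j :: s2) by move: us; rewrite cat_uniq => /and3P[].
  rewrite -capA' (indepF us2 FA') big_cons /A' eqxx; congr (_ * _)%E.
  have us2' : uniq s2 by move: us2 => /= /andP[].
  rewrite (indepF us2' FA); apply: eq_big_seq => i si.
  by case: eqVneq => // ij; move: js2; rewrite -ij si.
have fPf : P (f j @^-1` B) \is a fin_num.
  by apply: fin_num_measure; apply: (@mF j); exact: aj.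
have fPE : P E \is a fin_num by apply: fin_num_measure; exact: mcap.
rewrite PfE fineM// => E'; transitivity ((k * fine (P (f j @^-1` B)))%:E).
  rewrite /k -mulrA [X in _ * X]mulrC -E'; apply: eq_integral => x _.
  by congr EFin; rewrite /g indicI/=; ring.
by rewrite EFinM fineK.
Qed.

(** Both sides are linear in each factor, so a factor [f j] of arbitrary sign can be
    written as a difference of nonnegative ones; the factors indexed by [s2] are
    those that have been treated already. *)
Let has_mean_prod_mixed s1 s2 f m : uniq (s1 ++ s2) ->
  (forall i, i \in s1 ++ s2 -> has_mean P (f i) (m i) /\ adapted (F i) (f i)) ->
  (forall i, i \in s2 -> forall x, 0 <= f i x) ->
  has_mean P (fun x => \prod_(i <- s1 ++ s2) f i x) (\prod_(i <- s1 ++ s2) m i).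
Proof.
elim: s1 s2 f m => [|j s1 IH] s2 f m us fm f0.
  have fm' i : i \in s2 -> [/\ has_mean P (f i) (m i), adapted (F i) (f i)
                           & forall x, 0 <= f i x].
    by move=> si; have [? ?] := fm i si; split=> //; exact: f0.
  have us2 : uniq (s2 ++ [::]) by rewrite cats0.
  have := @has_mean_prod_indic s2 [::] f m (fun=> setT) us2 fm'.
  rewrite set_nil bigcap_set0 probability_setT mulr1 => h.
  rewrite (_ : (fun x => _) = (fun x => \prod_(i <- s2) f i x * \1_setT x)).
    by apply: h => i; rewrite in_nil.
  by apply/funext => x; rewrite indicT mulr1.
have us' : uniq (s1 ++ j :: s2) by rewrite (uniq_catCA s1 [:: j] s2).
have [js1 js2] : j \notin s1 /\ j \notin s2.
  by move: us; rewrite cat_cons cons_uniq mem_cat negb_or => /andP[/andP[]].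
have perm_s (G : I -> R) :
    \prod_(i <- (j :: s1) ++ s2) G i = G j * \prod_(i <- s1 ++ s2) G i.
  by rewrite big_cons.
have upd_s (G : I -> R) z : \prod_(i <- s1 ++ j :: s2) (if i == j then z else G i) =
    z * \prod_(i <- s1 ++ s2) G i.
  rewrite big_cat big_cons/= eqxx mulrCA -big_cat; congr (_ * _).
  apply: eq_big_seq => i; rewrite mem_cat; case: eqVneq => // ->.
  by rewrite (negPf js1) (negPf js2).
have [fj aj] := fm j (mem_head _ _).
have [fij _] := fj.
pose part (u : R -> R) i x := if i == j then u (f j x) else f i x.
have part_mean (u : R -> R) : measurable_fun setT u -> (forall y, 0 <= u y) ->
    P.-integrable setT (EFin \o (u \o f j)) ->
    has_mean P (fun x => u (f j x) * \prod_(i <- s1 ++ s2) f i x)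
      (fine 'E_P[u \o f j] * \prod_(i <- s1 ++ s2) m i).
  move=> mu u0 /has_mean_fine ui.
  have := IH (j :: s2) (part u)
    (fun i => if i == j then fine 'E_P[u \o f j] else m i) us'.
  rewrite upd_s (_ : (fun x => _) =
      (fun x => u (f j x) * \prod_(i <- s1 ++ s2) f i x)); last first.
    by apply/funext => x; rewrite upd_s.
  apply=> [i si|i]; last first.
    by rewrite inE /part; case: eqVneq => //= _ /f0.
  rewrite /part; case: eqVneq si => [-> _|ij si].
    by split=> //; exact: adapted_comp.
  apply: fm; rewrite mem_cat inE (negPf ij)/=.
  by move: si; rewrite mem_cat inE (negPf ij).
pose pos (y : R) := Num.max y 0; pose neg (y : R) := Num.max (- y) 0.
have mpos : measurable_fun setT pos by exact: measurable_maxr.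
have mneg : measurable_fun setT neg.
  by apply: measurable_maxr => //; exact: measurableT_comp.
have int_le (u : R -> R) : measurable_fun setT u ->
    (forall y, `|u y| <= `|y|) -> P.-integrable setT (EFin \o (u \o f j)).
  move=> mu uy; apply: le_integrable fij => //.
    by apply/measurable_EFinP; apply: measurableT_comp => //; exact: has_mean_meas fj.
  by move=> x _; rewrite /= lee_fin.
have ipos : P.-integrable setT (EFin \o (pos \o f j)).
  apply: int_le => // y; rewrite ger0_norm ?le_max ?lexx ?orbT//.
  by rewrite ge_max ler_norm normr_ge0.
have ineg : P.-integrable setT (EFin \o (neg \o f j)).
  apply: int_le => // y; rewrite ger0_norm ?le_max ?lexx ?orbT//.
  by rewrite ge_max -normrN ler_norm normr_ge0.
have posneg y : y = pos y - neg y.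
  by rewrite /pos /neg; case: (lerP y 0) => y0;
    [rewrite max_l ?oppr_ge0// sub0r opprK|rewrite max_r ?subr0// oppr_le0 ltW].
have hp := part_mean pos mpos _ ipos.
have hn := part_mean neg mneg _ ineg.
have mj : m j = fine 'E_P[pos \o f j] - fine 'E_P[neg \o f j].
  apply: (has_mean_uniq fj); rewrite -mulN1r.
  have fE : f j = (pos \o f j) \+ (fun x => -1 * (neg \o f j) x).
    by apply/funext => x; rewrite /= mulN1r -posneg.
  rewrite [X in has_mean P X _]fE.
  apply: has_meanD; first exact: has_mean_fine ipos.
  by apply: has_meanZ; exact: has_mean_fine ineg.
rewrite perm_s (_ : (fun x => _) =
  (fun x => pos (f j x) * \prod_(i <- s1 ++ s2) f i x) \+
  (fun x => -1 * (neg (f j x) * \prod_(i <- s1 ++ s2) f i x))); last first.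
  by apply/funext => x; rewrite perm_s/= {1}(posneg (f j x)) mulN1r mulrBl.
rewrite mj mulrBl -[X in _ + X]mulN1r; apply: has_meanD; last apply: has_meanZ.
  by apply: hp => y; rewrite le_max lexx orbT.
by apply: hn => y; rewrite le_max lexx orbT.
Qed.

Lemma has_mean_prod s f m : uniq s ->
  (forall i, i \in s -> has_mean P (f i) (m i) /\ adapted (F i) (f i)) ->
  has_mean P (fun x => \prod_(i <- s) f i x) (\prod_(i <- s) m i).
Proof.
move=> us fm; rewrite -(cats0 s).
by apply: has_mean_prod_mixed; rewrite ?cats0.
Qed.

End product_rule.

Section two_systems.
Context {d} {T : measurableType d} {R : realType} (P : probability T R).

Lemma has_meanM (G1 G2 : set (set T)) (f g : T -> R) a b :
  G1 `<=` measurable -> G2 `<=` measurable ->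
  independent_systems P G1 G2 ->
  has_mean P f a -> adapted G1 f -> has_mean P g b -> adapted G2 g ->
  has_mean P (fun x => f x * g x) (a * b).
Proof.
move=> mG1 mG2 G12 fa af gb ag.
pose F (i : bool) := if i then G1 else G2.
have mF i A : F i A -> measurable A by case: i; [exact: mG1|exact: mG2].
have indepF : mutually_independent_systems P F.
  have bcap s (A : bool -> set T) :
      \bigcap_(i in [set` s]) A i = \big[setI/setT]_(i <- s) A i.
    exact: bigcap_seq.
  move=> [|i [|j [|k s]]] A us FA; rewrite bcap ?(big_nil, big_cons).
  - by rewrite probability_setT.
  - by rewrite setIT mule1.
  - rewrite setIT mule1; have := FA j; have := FA i; move: us.
    rewrite /= !inE !eqxx orbT => + /(_ isT) Fi /(_ isT) Fj.
    case: i j Fi Fj {FA} => -[]// Fi Fj _; first exact: G12.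
    by rewrite setIC muleC; exact: G12.
  - by move: us {FA}; case: i; case: j; case: k; rewrite //= ?inE ?andbF.
have := @has_mean_prod _ _ _ P bool F mF indepF [:: true; false]
  (fun i => if i then f else g) (fun i => if i then a else b) isT.
rewrite !big_cons big_nil mulr1 (_ : (fun x => _) = (fun x => f x * g x)); last first.
  by apply/funext => x; rewrite !big_cons big_nil mulr1.
by apply=> -[].
Qed.

End two_systems.

(** * Integrals of functions known almost everywhere *)

Section lower_integral.
Local Open Scope ereal_scope.
Context {d} {T : measurableType d} {R : realType}.
Variable mu : {measure set T -> \bar R}.
Import HBNNSimple.

(** Let [h] be [g] outside a null set off which [f] and [g] agree.  Simple
    functions below [h] are below [f]; simple functions below [f] are below [h]
    once they are set to 0 on the null set, which does not change their
    integral. *)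
Let ge0_ae_eq_integral_nm (f g : T -> \bar R) : (forall x, 0 <= f x) ->
  measurable_fun setT g -> (forall x, 0 <= g x) ->
  {ae mu, forall x, f x = g x} -> \int[mu]_x f x = \int[mu]_x g x.
Proof.
move=> f0 mg g0 [N [mN muN fgN]].
have fg x : (~` N) x -> f x = g x by move=> Nx; apply: contrapT => /fgN.
have mCN := measurableC mN.
pose h := g \_ (~` N).
have mh : measurable_fun setT h.
  by apply/(measurable_restrictT _ _).1 => //; exact: measurable_funTS.
have h0 x : 0 <= h x by rewrite /h /patch; case: ifP.
have gh : \int[mu]_x g x = \int[mu]_x h x.
  by rewrite (ge0_negligible_integral mN)// setTD /h -integral_mkcond.
rewrite gh; apply/eqP; rewrite eq_le; apply/andP; split.
- rewrite ge0_integralTE//; apply: ge_ereal_sup => _ [k kf <-].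
  rewrite -integralT_nnsfun (ge0_negligible_integral mN)//; last 2 first.
    by apply/measurable_EFinP.
    by move=> x _; rewrite lee_fin.
  rewrite setTD integral_mkcond; apply: ge0_le_integral => //.
  + by move=> x _; rewrite /patch; case: ifP => //; rewrite lee_fin.
  + apply/(measurable_restrictT _ _).1 => //; apply: measurable_funTS.
    exact/measurable_EFinP.
  + move=> x _; rewrite /h /patch; case: ifPn => // /set_mem Nx.
    by rewrite -fg.
- rewrite !ge0_integralTE//; apply: ereal_sup_le => _ [k kh <-].
  exists k => // x; apply: le_trans (kh x) _.
  by rewrite /h /patch; case: ifPn => [/set_mem/fg <-|].
Qed.

Lemma ae_eq_integral_nonmeasurable (f g : T -> \bar R) :
  measurable_fun setT g -> {ae mu, forall x, f x = g x} ->
  \int[mu]_x f x = \int[mu]_x g x.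
Proof.
move=> mg fg; rewrite integralE [RHS]integralE.
congr (_ - _); apply: ge0_ae_eq_integral_nm => //.
- exact: measurable_funepos.
- by apply: filterS fg => x; rewrite !funeposE => ->.
- exact: measurable_funeneg.
- by apply: filterS fg => x; rewrite !funenegE => ->.
Qed.

End lower_integral.

(** For functions, such as the discrete quadratic variation, that are measurable only
    up to a null set. *)
Lemma expectation_ae_eq d (T : measurableType d) (R : realType)
    (P : probability T R) (f g : T -> R) c :
  {ae P, forall x, f x = g x} -> has_mean P g c -> ('E_P[f] = c%:E)%E.
Proof.
move=> fg gc; rewrite unlock -(proj2 gc).
apply: ae_eq_integral_nonmeasurable.
  by apply/measurable_EFinP; exact: has_mean_meas gc.
by move: fg; apply: filterS => x ->.
Qed.

(** * Moments of the standard normal law *)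

Section normal_moments.
Context {R : realType}.
Notation mu := lebesgue_measure.
Notation phi := (@normal_pdf R 0 1).

Lemma normal_pdf01E x : phi x = normal_peak 1 * expR (- (x ^+ 2 / 2)).
Proof.
rewrite normal_pdfE ?oner_eq0//= /normal_fun subr0 expr1n.
by rewrite mulNr.
Qed.

Lemma normal_pdf01N x : phi (- x) = phi x.
Proof. by rewrite !normal_pdf01E sqrrN. Qed.

Lemma is_derive_normal_pdf01 (x : R) : is_derive x 1 phi (- (x * phi x)).
Proof.
have -> : phi = fun x => normal_peak 1 * expR (- (x ^+ 2 / 2)).
  by apply/funext => y; exact: normal_pdf01E.
have : is_derive x 1 (fun x : R => - (x ^+ 2 / 2)) (- x).
  by apply: is_derive_eq; rewrite /GRing.scale/=; field.
move=> h.
by apply: is_derive_eq; rewrite /GRing.scale/=; ring.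
Qed.

(** The inequality [expR u >= u ^ 2 / 2] at [u = n ^ 2 / 2] bounds [phi n] by a constant
    multiple of [1 / n ^ 4]. *)
Lemma cvg_pow_normal_pdf01 q : (q < 4)%N ->
  (n%:R ^+ q * phi n%:R) @[n --> \oo] --> (0 : R).
Proof.
move=> q4.
have p0 := @normal_peak_ge0 R 1.
apply: (@squeeze_cvgr _ _ _ _ (cst 0) (fun n => 8 * normal_peak 1 / n%:R)).
- near=> n; have n0 : (0 < n)%N by near: n; exact: nbhs_infty_gt.
  have n1 : 1 <= n%:R :> R by rewrite ler1n.
  have n0' : 0 < n%:R :> R by rewrite ltr0n.
  rewrite mulr_ge0 ?exprn_ge0 ?normal_pdf_ge0//=.
  rewrite normal_pdf01E expRN.
  have e : (n%:R ^+ 2 / 2) ^+ 2 / 2 <= expR (n%:R ^+ 2 / 2) :> R.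
    have := @expR_ge1Dxn R (n%:R ^+ 2 / 2) 1.
    rewrite divr_ge0 ?exprn_ge0// => /(_ isT); apply: le_trans.
    by rewrite lerDr.
  apply: (@le_trans _ _ (n%:R ^+ 3 * (normal_peak 1 * (8 / n%:R ^+ 4)))).
    apply: ler_pM => //.
    + by rewrite mulr_ge0// invr_ge0 expR_ge0.
    + by rewrite ler_weXn2l.
    + rewrite ler_wpM2l// invf_ple ?posrE ?expR_gt0 ?divr_gt0 ?exprn_gt0//.
      apply: le_trans e; rewrite le_eqVlt; apply/orP; left; apply/eqP.
      by field; lra.
  rewrite le_eqVlt; apply/orP; left; apply/eqP; field.
  lra.
- exact: cvg_cst.
- rewrite -[X in _ --> X](mulr0 (8 * normal_peak 1)); apply: cvgMr.
  apply/gtr0_cvgV0; last exact: cvgr_idn.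
  by near=> n; rewrite ltr0n; near: n; exact: nbhs_infty_gt.
Unshelve. all: by end_near. Qed.

(** Integrate [x ^ (q + 1)] against [x * phi x], the derivative of [- phi]. *)
Lemma integral_normal_by_parts q (b : R) : 0 < b ->
  (\int[mu]_(x in `[0%R, b]) (x ^+ q.+2 * phi x)%:E =
   (q.+1%:R)%:E * \int[mu]_(x in `[0%R, b]) (x ^+ q * phi x)%:E
   - (b ^+ q.+1 * phi b)%:E)%E.
Proof.
move=> b0.
have cphi : continuous phi by apply: continuous_normal_pdf; rewrite oner_eq0.
have cX k : continuous (fun x : R => x ^+ k) by exact: exprn_continuous.
have dX (x : R) : derivable (fun x : R => x ^+ q.+1) x 1 by exact: exprn_derivable.
have within_cont (f : R -> R) : continuous f -> {within `[0, b], continuous f}.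
  exact: continuous_subspaceT.
have LR (f : R -> R) : (forall x, derivable f x 1) ->
    derivable_oo_LRcontinuous f 0 b.
  move=> df; have cf : continuous f.
    by move=> x; apply: differentiable_continuous; exact/derivable1_diffP.
  split=> [x _ //||].
    by apply: cvg_at_right_filter; exact: cf.
  by apply: cvg_at_left_filter; exact: cf.
pose G x := - phi x.
have dG (x : R) : is_derive x 1 G (x * phi x).
  have d := is_derive_normal_pdf01 x.
  have -> : G = - phi by [].
  by apply: is_derive_eq; rewrite opprK.
have F0 : (0 : R) ^+ q.+1 = 0 by rewrite expr0n.
have := @integration_by_parts R (fun x => x ^+ q.+1) G
  (fun x => q.+1%:R * x ^+ q) (fun x => x * phi x) 0 b b0.
rewrite F0 mul0r subr0.
have mphi (D : set R) k : measurable D -> measurable_fun D (fun x => (x ^+ k * phi x)%:E).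
  move=> mD; apply/measurable_EFinP; apply: measurable_funTS.
  by apply: measurable_funM; [exact: measurable_funX|exact: measurable_normal_pdf].
have phi0 k (x : R) : x \in `[0, b] -> 0 <= x ^+ k * phi x.
  by rewrite in_itv/= => /andP[x0 _]; rewrite mulr_ge0 ?exprn_ge0 ?normal_pdf_ge0.
have -> : (\int[mu]_(x in `[0%R, b]) (q.+1%:R * x ^+ q * G x)%:E =
  - (q.+1%:R%:E * \int[mu]_(x in `[0%R, b]) (x ^+ q * phi x)%:E))%E.
  rewrite -ge0_integralZl//=; last 2 first.
  - exact: mphi.
  - by move=> x; exact: phi0.
  rewrite -[RHS]integral_ge0N; last first.
    by move=> x xb; rewrite -EFinM lee_fin mulr_ge0//; exact: phi0.
  by apply: eq_integral => x _; rewrite -EFinM -EFinN; congr EFin; rewrite /G; ring.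
rewrite oppeK => parts.
transitivity (\int[mu]_(x in `[0%R, b]) (x ^+ q.+1 * (x * phi x))%:E)%E.
  by apply: eq_integral => x _; rewrite mulrA -exprSr.
rewrite parts//.
- by rewrite addeC mulrN EFinN.
- apply: within_cont => x; apply: cvgM; [exact: cvg_cst|exact: cX].
- exact: LR.
- by move=> x _; rewrite exp_derive1.
- by apply: within_cont => x; apply: cvgM; [exact: cvg_id|exact: cphi].
- by apply: LR => x; have [] := dG x.
- by move=> x _; have [_ <-] := dG x; rewrite derive1E.
Qed.

Let mpowphi (D : set R) k : measurable D ->
  measurable_fun D (fun x => (x ^+ k * phi x)%:E).
Proof.
move=> mD; apply/measurable_EFinP; apply: measurable_funTS.
by apply: measurable_funM; [exact: measurable_funX|exact: measurable_normal_pdf].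
Qed.

Let even_ge0 k (x : R) : ~~ odd k -> 0 <= x ^+ k * phi x.
Proof. by move=> k2; rewrite mulr_ge0 ?normal_pdf_ge0// exprn_even_ge0. Qed.

(** By symmetry the integral is twice that over the half line, where the integrand is
    nonnegative and the boundary term of the integration by parts vanishes at
    infinity. *)
Lemma integral_normal_pdf_rec q (c : R) : (q.+1 < 4)%N -> ~~ odd q ->
  (\int[mu]_x (x ^+ q * phi x)%:E = c%:E)%E ->
  (\int[mu]_x (x ^+ q.+2 * phi x)%:E = (q.+1%:R * c)%:E)%E.
Proof.
move=> q4 qe.
have cpow k : continuous (fun x : R => x ^+ k * phi x).
  move=> x; apply: cvgM; first exact: exprn_continuous.
  by apply: continuous_normal_pdf; rewrite oner_eq0.
have half k : ~~ odd k -> (\int[mu]_x (x ^+ k * phi x)%:E =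
    2%:E * \int[mu]_(x in `[0%R, +oo[) (x ^+ k * phi x)%:E)%E.
  move=> ke; rewrite ge0_symfun_integralT//.
  - by rewrite -set_itvcy.
  - by move=> x; exact: even_ge0.
  - by move=> x /=; rewrite normal_pdf01N exprNn -signr_odd (negPf ke) mul1r.
rewrite (half q)// (half q.+2)/= ?negbK// => hq.
have lim k : ~~ odd k ->
    (\int[mu]_(x in `[0%R, n%:R]) (x ^+ k * phi x)%:E @[n --> \oo] -->
    \int[mu]_(x in `[0%R, +oo[) (x ^+ k * phi x)%:E)%E.
  move=> ke; apply: ge0_cvgn_integral; first by move=> x; exact: even_ge0.
  by apply/measurable_EFinP; exact: mpowphi.
have e : (\int[mu]_(x in `[0%R, +oo[) (x ^+ q.+2 * phi x)%:E =
   q.+1%:R%:E * \int[mu]_(x in `[0%R, +oo[) (x ^+ q * phi x)%:E)%E.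
  have l2 := lim q.+2; rewrite /= negbK in l2.
  rewrite -(cvg_lim _ (l2 qe))//; apply/cvg_lim => //.
  have h : ((q.+1%:R%:E * \int[mu]_(x in `[0%R, n%:R]) (x ^+ q * phi x)%:E
      - (n%:R ^+ q.+1 * phi n%:R)%:E) @[n --> \oo] -->
      q.+1%:R%:E * \int[mu]_(x in `[0%R, +oo[) (x ^+ q * phi x)%:E - 0%:E)%E.
    apply: cvgeB; first by rewrite fin_num_adde_defl.
    - by apply: cvgeZl => //; exact: lim.
    - by apply: cvg_EFin; [exact: nearW|exact: cvg_pow_normal_pdf01].
  rewrite sube0 in h; apply: cvg_trans h; apply: near_eq_cvg.
  near=> n; rewrite integral_normal_by_parts// ltr0n.
  by near: n; exact: nbhs_infty_gt.
by rewrite e muleCA hq.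
Unshelve. all: by end_near. Qed.

Lemma normal_prob_density (f : R -> R) :
  measurable_fun setT f -> (forall x, 0 <= f x) ->
  (\int[normal_prob 0 1]_x (f x)%:E = \int[mu]_x (f x * phi x)%:E)%E.
Proof.
move=> mf f0.
have := @integral_density _ _ R mu (normal_prob 0 1) f phi 1 mf
  (measurable_normal_pdf 0 1) f0 (normal_pdf_ge0 0 1).
rewrite mul1e => <-.
  by apply: eq_integral => x _; rewrite mulrC.
move=> B mB; rewrite mul1e /= /normal_prob [RHS]integral_mkcond.
apply: eq_integral => x _; rewrite patchE indicE.
by case: (x \in _); rewrite ?mulr1 ?mulr0.
Qed.

Let mpow k : measurable_fun setT (fun x : R => x ^+ k).
Proof. exact: measurable_funX. Qed.

Notation Nm := (normal_prob 0 1 : probability _ R).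

Let moment_even q c : ~~ odd q -> (\int[mu]_x (x ^+ q * phi x)%:E = c%:E)%E ->
  has_mean Nm (fun x => x ^+ q) c.
Proof.
move=> qe qc; apply: has_mean_ge0.
- exact: mpow.
- by move=> x; exact: exprn_even_ge0.
- by rewrite normal_prob_density// => x; exact: exprn_even_ge0.
Qed.

Let int0 : (\int[mu]_x (x ^+ 0 * phi x)%:E = 1%:E)%E.
Proof.
by under eq_integral do rewrite expr0 mul1r; exact: integral_normal_pdf.
Qed.

Let int2 : (\int[mu]_x (x ^+ 2 * phi x)%:E = 1%:E)%E.
Proof. by rewrite (integral_normal_pdf_rec _ _ int0)// mulr1. Qed.

Let int4 : (\int[mu]_x (x ^+ 4 * phi x)%:E = 3%:E)%E.
Proof. by rewrite (integral_normal_pdf_rec _ _ int2)// mulr1. Qed.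

(** The law is invariant under [x |-> - x], so that [c = - c]. *)
Lemma normal_mean_oddfun (f : R -> R) (c : R) :
  has_mean Nm f c -> (forall x, f (- x) = - f x) -> c = 0.
Proof.
move=> fc fodd.
have mopp : measurable_fun setT (-%R : R -> R) by exact: oppr_measurable.
have Nopp B : measurable B -> pushforward Nm (-%R) B = Nm B.
  move=> mB; rewrite /pushforward /= /normal_prob.
  have mNB : measurable (-%R @^-1` B).
    by rewrite -[X in measurable X]setTI; exact: mopp.
  rewrite [LHS]integral_mkcond [RHS]integral_mkcond.
  pose psi : R -> \bar R := (fun x => (phi x)%:E) \_ B.
  have mpsi : measurable_fun setT psi.
    apply/(measurable_restrictT _ _).1 => //; apply: measurable_funTS.
    by apply/measurable_EFinP; exact: measurable_normal_pdf.
  have psi0 x : (0 <= psi x)%E.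
    by rewrite /psi patchE; case: ifP => //; rewrite lee_fin normal_pdf_ge0.
  transitivity (\int[pushforward mu (-%R : R -> measurableTypeR R)]_x psi x)%E.
    rewrite ge0_integral_pushforward//; apply: eq_integral => x _ /=.
    by rewrite /psi !patchE normal_pdf01N.
  by apply: eq_measure_integral => A mA _; exact: lebesgue_measureN.
have [fi fE] := fc; have mf := has_mean_meas fc.
have : (c%:E = - c%:E)%E.
  rewrite -{1}fE.
  transitivity (\int[pushforward Nm (-%R : R -> measurableTypeR R)]_x (f x)%:E)%E.
    by apply: eq_measure_integral => A mA _; apply/esym; exact: Nopp.
  have fN : (EFin \o f) \o -%R = EFin \o (fun x => -1 * f x).
    by apply/funext => x; rewrite /= fodd mulN1r.
  have [fNi fNE] := has_meanZ (-1) fc.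
  have mopp' : @measurable_fun _ _ (measurableTypeR R) (measurableTypeR R)
    setT -%R := mopp.
  rewrite (@integral_pushforward _ _ _ _ R _ mopp' Nm setT (EFin \o f))//.
  - by rewrite preimage_setT fN fNE mulN1r.
  - exact/measurable_EFinP.
  - by rewrite preimage_setT fN.
by case=> cc; lra.
Qed.

(** Only the moments up to order 4 are meant; higher orders default to 0. *)
Definition normal_moment (p : nat) : R := nth 0 [:: 1; 0; 1; 0; 3] p.

(** Even moments come from the recursion, odd ones from symmetry, their
    integrability being a consequence of that of [1 + x ^ 4]. *)
Lemma has_mean_normal_moment p : (p <= 4)%N ->
  has_mean Nm (fun x => x ^+ p) (normal_moment p).
Proof.
have odd_case q : odd q -> (q <= 4)%N -> has_mean Nm (fun x => x ^+ q) 0.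
  move=> qo q4.
  have : Nm.-integrable setT (EFin \o (fun x : R => x ^+ q)).
    have [+ _] := has_meanD (has_mean_cst Nm 1) (@moment_even 4 3 isT int4).
    apply: le_integrable => //.
      by apply/measurable_EFinP; exact: mpow.
    move=> x _; rewrite /= lee_fin normrX [leRHS]ger0_norm; last first.
      by rewrite addr_ge0// exprn_even_ge0.
    have [x1|x1] := leP `|x| 1.
      rewrite (le_trans (exprn_ile1 q (normr_ge0 _) x1))// lerDl exprn_even_ge0//.
    rewrite -[x ^+ 4]ger0_norm ?exprn_even_ge0// normrX.
    by rewrite (le_trans (ler_weXn2l (ltW x1) q4))// lerDr.
  move=> /has_mean_fine h.
  suff c0 : fine 'E_Nm[fun x : R => x ^+ q] = 0 by rewrite c0 in h.
  apply: (normal_mean_oddfun h) => x.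
  by rewrite exprNn -signr_odd qo mulN1r.
case: p => [|[|[|[|[|//]]]]] _; rewrite /normal_moment/=.
- exact: moment_even int0.
- exact: odd_case.
- exact: moment_even int2.
- exact: odd_case.
- exact: moment_even int4.
Qed.

End normal_moments.

(** * Equality in law and measurability of matrices *)

(** Means depend on the law only: both sides are integrals of [f] against the common
    image measure. *)
Lemma has_mean_transfer (d d' e : measure_display) (T : measurableType d)
    (T' : measurableType d') (S : measurableType e) (R : realType)
    (P : probability T R) (P' : probability T' R)
    (U : T -> S) (V : T' -> S) (f : S -> R) c :
  measurable_fun setT U -> measurable_fun setT V ->
  (forall A, measurable A -> P (U @^-1` A) = P' (V @^-1` A)) ->
  measurable_fun setT f -> has_mean P' (f \o V) c -> has_mean P (f \o U) c.
Proof.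
move=> mU mV UV mf [fVi fVc].
pose U' : {mfun T >-> S} := HB.pack U (isMeasurableFun.Build _ _ T S U mU).
pose V' : {mfun T' >-> S} := HB.pack V (isMeasurableFun.Build _ _ T' S V mV).
have law (g : S -> \bar R) :
    (\int[pushforward P' V]_y g y = \int[pushforward P U]_y g y)%E.
  rewrite -[U]/(U' : _ -> _) -[V]/(V' : _ -> _).
  by apply: eq_measure_integral => A mA _; rewrite /= /pushforward UV.
have mEf : measurable_fun setT (EFin \o f) by exact/measurable_EFinP.
have fUi : P.-integrable setT (EFin \o (f \o U)).
  apply/integrableP; split; first by apply: measurableT_comp mEf mU.
  have /integrableP[_] := fVi; apply: le_lt_trans.
  have mg : measurable_fun setT (fun y => `|(f y)%:E|)%E.
    exact: measurableT_comp.
  rewrite -(@ge0_integral_pushforward _ _ _ _ _ _ mU P setT _ measurableT mg)//.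
  rewrite -(@ge0_integral_pushforward _ _ _ _ _ _ mV P' setT _ measurableT mg)//.
  by rewrite law.
split=> //.
rewrite -fVc -(@integral_pushforward _ _ _ _ R _ mU P setT _ mEf)//.
rewrite -(@integral_pushforward _ _ _ _ R _ mV P' setT _ mEf)//; exact/esym/law.
Qed.

Section matrix_measurable.
Context {e : measure_display} {S : measurableType e} {m n : nat}.

Lemma measurable_coord i j : measurable_fun setT (fun A : 'M[S]_(m, n) => A i j).
Proof.
move=> _ B mB; apply: sub_sigma_algebra; exists (i, j) => //=.
by exists B.
Qed.

Lemma measurable_fun_mx (d : measure_display) (T : measurableType d)
    (f : T -> 'M[S]_(m, n)) :
  (forall i j, measurable_fun setT (fun x => f x i j)) -> measurable_fun setT f.
Proof.
move=> mf; pose G := \bigcup_(ij : 'I_m * 'I_n) preimage_set_system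
  [set: 'M[S]_(m, n)] (fun A => A ij.1 ij.2) measurable.
apply: (@measurability _ _ _ _ _ _ G) => //.
move=> _ [_ [[i j] _ [B mB <-]] <-].
by have := mf i j measurableT B mB; rewrite !setTI.
Qed.

End matrix_measurable.

Lemma preimage_system_measurable (d e : measure_display) (T : measurableType d)
    (S : measurableType e) (U : {mfun T >-> S}) :
  preimage_set_system setT U measurable `<=` measurable.
Proof. by move=> _ [B mB <-]; apply: (@measurable_funPT _ _ _ _ U). Qed.

Lemma adapted_preimage (d e : measure_display) (T : measurableType d)
    (S : measurableType e) (R : realType) (U : T -> S) (f : S -> R) :
  measurable_fun setT f ->
  adapted (preimage_set_system setT U measurable) (f \o U).
Proof.
move=> mf B mB; exists (f @^-1` B); last by rewrite setTI.
by rewrite -[X in measurable X]setTI; exact: mf.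
Qed.

Section delta_sums.
Variables (R : comNzRingType) (d : nat).
Implicit Types (u v y z : 'I_d -> R).

Lemma sum_delta i u : \sum_j u j * (i == j)%:R = u i.
Proof.
rewrite (bigD1 i)//= eqxx mulr1 big1 ?addr0// => j ij.
by rewrite eq_sym (negPf ij) mulr0.
Qed.

(** The three pairings of four indices, each of which leaves two free sums. *)
Lemma sum4_delta u v y z :
  \sum_i \sum_j \sum_k \sum_l (u i * v j * y k * z l) *
    ((i == j)%:R * (k == l)%:R + (i == k)%:R * (j == l)%:R
     + (i == l)%:R * (j == k)%:R) =
  (\sum_i u i * v i) * (\sum_i y i * z i) +
  (\sum_i u i * y i) * (\sum_i v i * z i) +
  (\sum_i u i * z i) * (\sum_i v i * y i).
Proof.
have E a b : (\sum_(i : 'I_d) a i) * (\sum_(i : 'I_d) b i) =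
    \sum_i \sum_j (a i * b j) :> R.
  exact: big_distrlr.
rewrite !E -!big_split/=; apply: eq_bigr => i _.
under eq_bigr => j _ do under eq_bigr => k _ do under eq_bigr => l _ do
  rewrite mulrDr mulrDr.
under eq_bigr => j _ do under eq_bigr => k _ do rewrite !big_split/=.
under eq_bigr => j _ do rewrite !big_split/=.
rewrite !big_split/=; congr (_ + _ + _).
- under eq_bigr => j _ do under eq_bigr => k _ do
    (under eq_bigr => l _ do rewrite mulrA; rewrite sum_delta).
  rewrite exchange_big/=; apply: eq_bigr => k _.
  transitivity (\sum_j (u i * v j * (y k * z k)) * (i == j)%:R).
    by apply: eq_bigr => j _; ring.
  by rewrite sum_delta.
- under eq_bigr => j _ do under eq_bigr => k _ do
    (under eq_bigr => l _ do rewrite mulrA; rewrite sum_delta).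
  apply: eq_bigr => j _.
  transitivity (\sum_k (u i * y k * (v j * z j)) * (i == k)%:R).
    by apply: eq_bigr => k _; ring.
  by rewrite sum_delta.
- apply: eq_bigr => j _.
  rewrite exchange_big/=.
  transitivity (\sum_l (\sum_k (u i * v j * y k * z l) * (j == k)%:R) * (i == l)%:R).
    apply: eq_bigr => l _; rewrite mulr_suml; apply: eq_bigr => k _; ring.
  by rewrite sum_delta sum_delta; ring.
Qed.

End delta_sums.

(** * Moments of Gaussian vectors *)

Section gaussian_vector.
Context {d : measure_display} {T : measurableType d} {R : realType}.
Variables (P : probability T R) (n : nat) (X : {RV P >-> 'cV[R]_n}).
Hypothesis Xnorm : standard_normal_vector X.

Let mXi i : measurable_fun setT (fun w => X w i 0).
Proof. by apply: measurableT_comp (measurable_coord i 0) _. Qed.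

Lemma has_mean_coord_pow i p : (p <= 4)%N ->
  has_mean P (fun w => X w i 0 ^+ p) (normal_moment p).
Proof.
move=> p4.
apply: (@has_mean_transfer _ _ _ T _ (measurableTypeR R) R P (normal_prob 0 1)
  (fun w => X w i 0) idfun (fun x => x ^+ p)).
- exact: mXi.
- exact: measurable_id.
- by move=> A mA; exact: Xnorm.2.
- exact: measurable_funX.
- exact: has_mean_normal_moment.
Qed.

Lemma has_mean_monomial (p : 'I_n -> nat) : (forall m, (p m <= 4)%N) ->
  has_mean P (fun w => \prod_m X w m 0 ^+ p m) (\prod_m normal_moment (p m)).
Proof.
move=> p4.
apply: (@has_mean_prod _ _ _ P _ (fun i : 'I_n =>
  g_sigma_algebra_preimage (fun w => X w i 0)) _ Xnorm.1 _
  (fun m w => X w m 0 ^+ p m)).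
- move=> i A [B mB <-]; exact: mXi.
- exact: index_enum_uniq.
- move=> i _; split; first exact: has_mean_coord_pow.
  have := @adapted_preimage _ _ T _ R (fun w => X w i 0) (fun x : R => x ^+ p i).
  by apply; exact: measurable_funX.
Qed.

Let coordE (x : 'cV[R]_n) i : x i 0 = \prod_m x m 0 ^+ (i == m).
Proof.
rewrite (bigD1 i)//= eqxx expr1 big1 ?mulr1// => m im.
by rewrite eq_sym (negPf im) expr0.
Qed.

Let prod_moment0 (p : 'I_n -> nat) a : normal_moment (p a) = 0 :> R ->
  \prod_m normal_moment (p m) = 0 :> R.
Proof. by move=> pa; rewrite (bigD1 a)//= pa mul0r. Qed.

Let prod_moment1 (p : 'I_n -> nat) a b : a != b -> p a = 2 -> p b = 2 ->
  (forall m, m != a -> m != b -> p m = 0%N) ->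
  \prod_m normal_moment (p m) = 1 :> R.
Proof.
move=> ab pa pb p0; rewrite (bigD1 a)//= (bigD1 b)//=; last by rewrite eq_sym.
rewrite pa pb !mul1r big1// => m /andP[ma mb].
by rewrite p0.
Qed.

Lemma has_mean_coord2 i j : has_mean P (fun w => X w i 0 * X w j 0) (i == j)%:R.
Proof.
pose p m := ((i == m) + (j == m))%N.
have := @has_mean_monomial p; rewrite (_ : (fun w => _) =
    (fun w => X w i 0 * X w j 0)); last first.
  apply/funext => w; rewrite (coordE (X w) i) (coordE (X w) j) -big_split/=.
  by apply: eq_bigr => m _; rewrite /p exprD.
rewrite (_ : \prod_m _ = (i == j)%:R).
  by apply=> m; rewrite /p; case: (i == m); case: (j == m).
rewrite /p; have [<-|ij] := eqVneq i j.
  rewrite (bigD1 i)//= eqxx big1 ?mulr1// => m im.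
  by rewrite eq_sym (negPf im).
by rewrite (@prod_moment0 _ i)// eqxx eq_sym (negPf ij).
Qed.

(** Group the four factors by coordinate: the mean is the product over [m] of the
    moment of order [p m], where [p m] counts the indices equal to [m].  It
    vanishes as soon as some [p m] is odd, so only the coincidences in pairs
    contribute, and when all indices coincide the three pairings add up to the
    fourth moment 3. *)
Lemma has_mean_coord4 i j k l :
  has_mean P (fun w => X w i 0 * X w j 0 * X w k 0 * X w l 0)
    ((i == j)%:R * (k == l)%:R + (i == k)%:R * (j == l)%:R
     + (i == l)%:R * (j == k)%:R).
Proof.
pose p m := ((i == m) + (j == m) + (k == m) + (l == m))%N.
have := @has_mean_monomial p; rewrite (_ : (fun w => _) =
    (fun w => X w i 0 * X w j 0 * X w k 0 * X w l 0)); last first.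
  apply/funext => w; rewrite (coordE (X w) i) (coordE (X w) j).
  rewrite (coordE (X w) k) (coordE (X w) l) -!big_split/=.
  by apply: eq_bigr => m _; rewrite /p !exprD.
rewrite (_ : \prod_m _ = (i == j)%:R * (k == l)%:R + (i == k)%:R * (j == l)%:R
     + (i == l)%:R * (j == k)%:R).
  by apply=> m; rewrite /p; case: (i == m); case: (j == m); case: (k == m);
    case: (l == m).
rewrite {}/p; have [<-{j}|ij] := eqVneq i j.
  have [<-{l}|kl] := eqVneq k l.
    have [<-{k}|ik] := eqVneq i k.
      rewrite (bigD1 i)//= eqxx big1; first by rewrite /normal_moment/=; ring.
      by move=> m im; rewrite eq_sym (negPf im).
    rewrite (@prod_moment1 _ i k)//.
    - by rewrite !mulr0 !addr0 mulr1.
    - by rewrite eqxx eq_sym (negPf ik).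
    - by rewrite eqxx (negPf ik).
    - by move=> m; rewrite !(eq_sym m) => /negPf -> /negPf ->.
  rewrite (@prod_moment0 _ k).
    have [->|ik] := eqVneq i k; last by rewrite !(mul0r, mulr0, addr0).
    by rewrite (negPf kl) !(mul0r, mulr0, addr0).
  by rewrite eqxx (eq_sym l) (negPf kl); case: eqVneq.
have [<-{k}|ik] := eqVneq i k.
  rewrite (eq_sym j i) (negPf ij) mulr0 addr0 mul0r add0r mul1r.
  have [<-{l}|jl] := eqVneq j l.
    rewrite (@prod_moment1 _ i j)//.
    - by rewrite eqxx eq_sym (negPf ij).
    - by rewrite eqxx (negPf ij).
    - by move=> m; rewrite !(eq_sym m) => /negPf -> /negPf ->.
  by rewrite (@prod_moment0 _ j)// eqxx (negPf ij) (eq_sym l) (negPf jl).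
rewrite !mul0r !add0r.
have [<-{l}|il] := eqVneq i l.
  rewrite mul1r; have [<-{k ik}|jk] := eqVneq j k.
    rewrite (@prod_moment1 _ i j)//.
    - by rewrite eqxx eq_sym (negPf ij).
    - by rewrite eqxx (negPf ij).
    - by move=> m; rewrite !(eq_sym m) => /negPf -> /negPf ->.
  by rewrite (@prod_moment0 _ j)// eqxx (negPf ij) (eq_sym k) (negPf jk).
rewrite mul0r (@prod_moment0 _ i)// eqxx !(eq_sym _ i).
by rewrite (negPf ij) (negPf ik) (negPf il).
Qed.

Variable B : 'M[R]_n.
Let W w := B *m X w.
Let C := B *m B^T.

Lemma has_mean_linear2 a b : has_mean P (fun w => W w a 0 * W w b 0) (C a b).
Proof.
rewrite (_ : (fun w => _) = (fun w => \sum_i \sum_j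
    (B a i * B b j) * (X w i 0 * X w j 0))); last first.
  apply/funext => w; rewrite !mxE big_distrlr/=.
  by apply: eq_bigr => i _; apply: eq_bigr => j _; ring.
rewrite (_ : C a b = \sum_i \sum_j (B a i * B b j) * (i == j)%:R).
  by do 2 apply: has_mean_sum => ? _; apply: has_meanZ; exact: has_mean_coord2.
rewrite mxE; apply: eq_bigr => i _; rewrite mxE.
by rewrite (@sum_delta _ _ i (fun j => B a i * B b j)).
Qed.

(** Isserlis' formula for the linear images [B X], by expansion into monomials. *)
Lemma has_mean_linear4 a b c e :
  has_mean P (fun w => (W w a 0 * W w b 0) * (W w c 0 * W w e 0))
    (C a b * C c e + C a c * C b e + C a e * C b c).
Proof.
rewrite (_ : (fun w => _) = (fun w => \sum_i \sum_j \sum_k \sum_l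
    (B a i * B b j * B c k * B e l) *
    (X w i 0 * X w j 0 * X w k 0 * X w l 0))); last first.
  apply/funext => w; rewrite ![W w _ 0]mxE.
  rewrite big_distrlr/= mulr_suml; apply: eq_bigr => i _.
  rewrite mulr_suml; apply: eq_bigr => j _.
  rewrite big_distrlr/= mulr_sumr; apply: eq_bigr => k _.
  rewrite mulr_sumr; apply: eq_bigr => l _; ring.
have CE x y : C x y = \sum_i B x i * B y i.
  by rewrite mxE; apply: eq_bigr => i _; rewrite mxE.
rewrite !CE -sum4_delta.
by do 4 apply: has_mean_sum => ? _; apply: has_meanZ; exact: has_mean_coord4.
Qed.

End gaussian_vector.

(** * Jumps of a path that counts with unit steps *)

Section unit_jump_path.
Variables (R : realType) (d : nat) (f : R -> nat) (y : nat -> 'cV[R]_d).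
Variable l : R -> 'cV[R]_d.
Hypothesis f0 : f 0 = 0%N.
Hypothesis f_nd : forall s t : R, 0 <= s -> s <= t -> (f s <= f t)%N.
Hypothesis f_rc : forall t : R, 0 <= t ->
  exists2 e, 0 < e & forall u, t <= u < t + e -> f u = f t.
Hypothesis f_unit : forall s : R, 0 < s <= 1 ->
  exists2 t, 0 <= t < s & (f s <= (f t).+1)%N.
Hypothesis lE : forall t : R, 0 <= t -> l t = \sum_(k < f t) y k.

Let J := [set s : R | forall t : R, 0 <= t < s -> (f t < f s)%N].

Lemma jump_left_const s t m : 0 <= t < s ->
  (forall u, t <= u < s -> f u = m) -> jump l s = l s - \sum_(k < m) y k.
Proof.
move=> /andP[t0 ts] fm; rewrite /jump; congr (_ - _).
apply/colP => i; rewrite mxE; apply: lim_near_cst => //.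
near=> u; rewrite lE; last by apply: le_trans t0 _; near: u; exact: nbhs_left_ge.
rewrite fm//; apply/andP; split; near: u; [exact: nbhs_left_ge|exact: nbhs_left_lt].
Unshelve. all: by end_near. Qed.

Lemma jump_inside s : 0 < s <= 1 -> J s -> jump l s = y (f s).-1.
Proof.
move=> s01 Js; have [t tb fst] := f_unit s01; have /andP[t0 ts] := tb.
have fu u : t <= u < s -> f u = (f s).-1.
  move=> /andP[tu us].
  have us' : (f u < f s)%N by apply: Js; rewrite us (le_trans t0).
  have tu' := f_nd t0 tu.
  apply/eqP; rewrite -eqSS prednK; last exact: leq_ltn_trans us'.
  by rewrite eqn_leq us' (leq_trans fst).
have fs0 : (0 < f s)%N by apply: leq_ltn_trans (Js t tb).
rewrite (jump_left_const tb fu) lE ?(le_trans t0 (ltW ts))//.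
by case: (f s) fs0 => // m _; rewrite big_ord_recr/= addrAC subrr add0r.
Qed.

Lemma jump_outside s : 0 < s -> ~ J s -> jump l s = 0.
Proof.
move=> s0 /existsNP[t] /not_implyP[tb]; have /andP[t0 ts] := tb.
move=> /negP; rewrite -leqNgt => fst.
have fu u : t <= u < s -> f u = f s.
  move=> /andP[tu us]; apply/eqP; rewrite eqn_leq f_nd ?(le_trans t0 tu) ?ltW//=.
  exact: leq_trans (f_nd t0 tu).
by rewrite (jump_left_const tb fu) lE ?subrr// ltW.
Qed.

(** The inverse sends [k] to the first time at which [f] exceeds [k]; it is attained
    by right continuity, and there [f] equals [k + 1] because it cannot jump by
    more than 1. *)
Lemma jump_times_bij : set_bij (`]0, 1] `&` J) `I_(f 1) (fun s => (f s).-1).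
Proof.
have fpos s : 0 < s -> J s -> (0 < f s)%N.
  by move=> s0 Js; apply: leq_ltn_trans (Js 0 _); rewrite ?lexx.
split.
- move=> s [/=]; rewrite in_itv/= => /andP[s0 s1] Js.
  have fs := fpos s s0 Js; have := f_nd (ltW s0) s1.
  by rewrite -{1}(prednK fs).
- move=> s s' /set_mem[/=]; rewrite in_itv/= => /andP[s0 s1] Js.
  move=> /set_mem[/=]; rewrite in_itv/= => /andP[s'0 s'1] Js' ss'.
  have fs := fpos s s0 Js; have fs' := fpos s' s'0 Js'.
  have ff : f s = f s' by rewrite -(prednK fs) ss' prednK.
  case: (ltgtP s s') => // h.
  + by have := Js' s; rewrite h (ltW s0) ff ltnn => /(_ isT).
  + by have := Js s'; rewrite h (ltW s'0) ff ltnn => /(_ isT).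
move=> k /= kf1.
pose A := [set t | 0 <= t /\ (k < f t)%N].
have A1 : A 1 by split.
have lA : lbound A 0 by move=> t [].
have hA : has_lbound A by exists 0.
pose s := inf A.
have s0 : 0 <= s by apply: lb_le_inf => //; exists 1.
have s1 : s <= 1 by exact: ge_inf.
have [e e0 fe] := f_rc s0.
have kfs : (k < f s)%N.
  have [|t [t0 kt] te] := @inf_adherent R A e e0; first by split => //; exists 1.
  rewrite -(fe t)// te andbT; apply: ge_inf => //.
have s_gt0 : 0 < s.
  by rewrite lt_neqAle s0 andbT; apply/eqP => s0'; move: kfs; rewrite -s0' f0.
have below t : 0 <= t < s -> (f t <= k)%N.
  move=> /andP[t0 ts]; rewrite leqNgt; apply/negP => kt.
  by move: ts; rewrite ltNge => /negP; apply; exact: ge_inf.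
exists s; last first.
  have s01 : 0 < s <= 1 by rewrite s_gt0.
  have [t tb fst] := f_unit s01; have ftk := below t tb.
  apply/eqP; rewrite /= -eqSS prednK ?(leq_trans _ kfs)//.
  by rewrite eqn_leq kfs (leq_trans fst).
split=> /=; first by rewrite in_itv/= s_gt0.
by move=> t /below; move/leq_ltn_trans; apply.
Qed.

(** At a jump time [s] of [f] the jump of [l] is the summand with index [f s - 1], and
    elsewhere [l] does not jump; so the sum over ]0, 1] is reindexed by
    [jump_times_bij]. *)
Lemma discrete_qv_unit_jumps :
  discrete_qv l 1 = \sum_(k < f 1) y k *m (y k)^T.
Proof.
apply/matrixP => i j; rewrite mxE.
pose a k : R := (y k *m (y k)^T) i j.
(* to be used with the positive and the negative part as [g] *)
have E (g : R -> \bar R) : g 0 = 0%E -> (forall x, 0 <= g x)%E ->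
    (\esum_(s in `]0%R, 1%R]) g ((jump l s *m (jump l s)^T) i j) =
     \sum_(k < f 1) g (a k))%E.
  move=> g0 gge0.
  transitivity (\esum_(s in `]0%R, 1%R]) (if s \in J then g (a (f s).-1) else 0))%E.
    apply: eq_esum => s /=; rewrite in_itv/= => s01.
    case: ifPn => [/set_mem Js|/negP sJ]; first by rewrite (jump_inside s01 Js).
    rewrite (jump_outside _ _) ?mul0mx ?mxE//; first by case/andP: s01.
    by move=> Js; apply: sJ; exact: mem_set.
  rewrite -esum_mkcondr -(@reindex_esum _ _ _ _ _ _ (fun k => g (a k)) jump_times_bij).
  by rewrite esum_fset// (fsbig_ord _ _ (fun k => g (a k))).
rewrite /abs_sum.
have -> : (\esum_(s in `]0%R, 1%R]) (EFin \o (fun s => (jump l s *m (jump l s)^T) i j))^\+ s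
    = \sum_(k < f 1) (Num.max (a k) 0)%:E)%E.
  rewrite -(E (fun x => (Num.max x 0)%:E)) ?maxxx//.
  - by apply: eq_esum => s _; rewrite funeposE/= EFin_max.
  - by move=> x; rewrite lee_fin le_max lexx orbT.
have -> : (\esum_(s in `]0%R, 1%R]) (EFin \o (fun s => (jump l s *m (jump l s)^T) i j))^\- s
    = \sum_(k < f 1) (Num.max (- a k) 0)%:E)%E.
  rewrite -(E (fun x => (Num.max (- x) 0)%:E)) ?oppr0 ?maxxx//.
  - by apply: eq_esum => s _; rewrite funenegE/= EFin_max.
  - by move=> x; rewrite lee_fin le_max lexx orbT.
rewrite !sumEFin -EFinB/= -sumrB summxE; apply: eq_bigr => k _.
rewrite -/(a k); case: (lerP (a k) 0) => ak.
  by rewrite max_l ?oppr_ge0// sub0r opprK.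
by rewrite max_r ?subr0// oppr_le0 ltW.
Qed.

End unit_jump_path.

(** * Poisson weights and increments *)

Section poisson_sums.
Variables (R : realType) (r : R).
Hypothesis r0 : 0 < r.
Notation p := (poisson_pmf r).

Lemma poisson_pmfS n : n.+1%:R * p n.+1 = r * p n.
Proof.
rewrite /poisson_pmf r0 factS natrM exprS invfM.
have n0 : n.+1%:R != 0 :> R by rewrite pnatr_eq0.
rewrite [LHS](_ : _ = (n.+1%:R * n.+1%:R^-1) *
    (r * (r ^+ n * n`!%:R^-1 * expR (- r)))); last by ring.
by rewrite divff// mul1r.
Qed.

Lemma cvg_series_poisson_pmf : series p @ \oo --> (1 : R).
Proof.
have -> : p = fun n => expR (- r) * exp_coeff r n.
  by apply/funext => n; rewrite /poisson_pmf r0 mulrC.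
have -> : series (fun n => expR (- r) * exp_coeff r n) =
    fun n => expR (- r) * series (exp_coeff r) n.
  by apply/funext => n; rewrite /series/= mulr_sumr.
rewrite -(mulVf (lt0r_neq0 (expR_gt0 r))) -expRN; apply: cvgMr.
exact: is_cvg_series_exp_coeff.
Qed.

(** The identity [(n + 1) p(n + 1) = r p(n)] removes a factor [n], respectively
    [n (n - 1)], at the cost of a shift of the partial sums of [p]. *)
Lemma cvg_series_poisson_moments (A B : R) :
  series (fun n => p n * (A * n%:R + B * (n%:R * (n%:R - 1)))) @ \oo -->
  A * r + B * r ^+ 2.
Proof.
have S1 n : series (fun n => p n * n%:R) n.+1 = r * series p n.
  rewrite /series/= big_nat_recl//= mulr0 add0r mulr_sumr.
  by apply: eq_bigr => i _; rewrite mulrC poisson_pmfS.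
have S2 n : series (fun n => p n * (n%:R * (n%:R - 1))) n.+2 = r ^+ 2 * series p n.
  rewrite /series/= big_nat_recl//= mul0r mulr0 add0r.
  rewrite big_nat_recl//= subrr !mulr0 add0r mulr_sumr.
  apply: eq_bigr => i _.
  rewrite -[i.+2%:R - 1]/(i.+2%:R - 1%:R) -natrB// subn1/=.
  by rewrite mulrCA mulrA poisson_pmfS -mulrA [p _ * _]mulrC poisson_pmfS; ring.
have -> : series (fun n => p n * (A * n%:R + B * (n%:R * (n%:R - 1)))) =
    fun n => A * series (fun n => p n * n%:R) n +
             B * series (fun n => p n * (n%:R * (n%:R - 1))) n.
  apply/funext => n; rewrite /series/= !mulr_sumr -big_split/=.
  by apply: eq_bigr => i _; ring.
have lim c : c * series p n @[n --> \oo] --> c.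
  by rewrite -[X in _ --> X]mulr1; apply: cvgMr; exact: cvg_series_poisson_pmf.
apply: cvgD; apply: cvgMr.
- rewrite -cvg_shiftS/=; under eq_fun do rewrite S1; exact: lim.
- rewrite -(cvg_shiftn 2)/=; under eq_fun do rewrite addn2 S2; exact: lim.
Qed.

Lemma nneseries_poisson_pmf : (\sum_(n <oo) (p n)%:E = 1%:E)%E.
Proof.
apply/cvg_lim => //; rewrite (_ : (fun n => _) = EFin \o series p).
  by apply: cvg_EFin; [exact: nearW|exact: cvg_series_poisson_pmf].
by apply/funext => n; rewrite /= sumEFin.
Qed.

(** The left-hand side is [1 - (1 + r) exp(- r)], and [exp(- r) >= 1 - r]. *)
Lemma poisson_pmf_ge2 : 1 - p 0 - p 1 <= r ^+ 2.
Proof.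
rewrite /poisson_pmf r0 expr0 expr1 !factE/= !invr1 !mulr1 mul1r.
have e1 : 0 <= expR (- r) - (1 - r) by rewrite subr_ge0 expR_ge1Dx.
have r1 : 0 <= 1 + r by rewrite addr_ge0// ltW.
by have := mulr_ge0 r1 e1; nra.
Qed.

End poisson_sums.

Section poisson_paths.
Context {disp} {T : measurableType disp} {R : realType} (P : probability T R).
Variables (r : R) (N : R -> {RV P >-> nat}).
Hypothesis r0 : 0 < r.
Hypothesis Npois : poisson_process r N.

Let D s t k := [set w | N t w = (N s w + k)%N].

Let mN t (B : set nat) : measurable (N t @^-1` B).
Proof. by rewrite -[X in measurable X]setTI; exact: (measurable_funPT (N t)). Qed.

Let mD s t k : measurable (D s t k).
Proof.
rewrite (_ : D s t k = \bigcup_j (N s @^-1` [set j] `&` N t @^-1` [set (j + k)%N])).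
  by apply: bigcupT_measurable => j; apply: measurableI; exact: mN.
apply/seteqP; split=> [w wD|w [j _ [/= Ns Nt]]].
  by exists (N s w).
by rewrite /D /= Ns Nt.
Qed.

Let PD s t k : 0 <= s -> s < t -> P (D s t k) = (poisson_pmf (r * (t - s)) k)%:E.
Proof.
move=> s0 st; have [_ _ <- // _] := Npois; congr (P _).
apply/seteqP; split=> w /=.
  by move=> ->; rewrite natrD addrAC subrr add0r.
by move/eqP; rewrite subr_eq -natrD eqr_nat addnC => /eqP.
Qed.

Let rate_gt0 s t : s < t -> 0 < r * (t - s).
Proof. by move=> st; rewrite mulr_gt0// subr_gt0. Qed.

Let trivD s t : trivIset setT (D s t).
Proof.
apply/trivIsetP => i j _ _ ij; apply/seteqP; split=> // w [Ni Nj].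
by move: Ni; rewrite /D /= Nj => /eqP; rewrite eqn_add2l => /eqP h; rewrite h eqxx in ij.
Qed.

(** The probabilities that the increment is a given natural number add up to 1. *)
Lemma poisson_nd_ae s t : 0 <= s -> s < t -> {ae P, forall w, (N s w <= N t w)%N}.
Proof.
move=> s0 st.
have mU : measurable (\bigcup_k D s t k) by exact: bigcupT_measurable.
have PU : P (\bigcup_k D s t k) = 1%E.
  rewrite measure_semi_bigcup//.
  rewrite -[RHS](nneseries_poisson_pmf (rate_gt0 st)).
  by apply: eq_eseriesr => k _; exact: PD.
exists (~` \bigcup_k D s t k); split; first exact: measurableC.
  by rewrite probability_setC// PU subee.
move=> w /= st'; apply: contra_not st' => -[k _ ->]; exact: leq_addr.
Qed.

Lemma poisson_double_jump s t : 0 <= s -> s < t ->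
  (P (~` (D s t 0 `|` D s t 1)) <= ((r * (t - s)) ^+ 2)%:E)%E.
Proof.
move=> s0 st; rewrite probability_setC; last exact: measurableU.
pose q := poisson_pmf (r * (t - s)).
have -> : P (D s t 0 `|` D s t 1) = (q 0 + q 1)%:E.
  rewrite measureU//; last by have /trivIsetP := @trivD s t; exact.
  by rewrite EFinD; congr (_ + _)%E; exact: PD.
rewrite -EFinB lee_fin opprD addrA.
exact: poisson_pmf_ge2 (rate_gt0 st).
Qed.

(** The probability that some of the [n] increments over the grid of mesh [1 / n]
    exceeds 1 is at most [n * (r / n) ^ 2 = r ^ 2 / n]; so almost surely this
    fails for at least one [n].  On such a grid no jump can exceed 1, since a
    monotone path has its jump at [s] bounded by the increment over the cell that
    contains [s]. *)
Lemma poisson_unit_grid_ae : {ae P, forall w, exists2 n, (0 < n)%N &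
  forall i, (i < n)%N -> (N (i.+1%:R / n%:R) w <= (N (i%:R / n%:R) w).+1)%N}.
Proof.
pose bad n i := ~` (D (i%:R / n.+1%:R) (i.+1%:R / n.+1%:R) 0
                `|` D (i%:R / n.+1%:R) (i.+1%:R / n.+1%:R) 1).
have mbad n i : measurable (bad n i) by apply: measurableC; exact: measurableU.
pose Bad n := \big[setU/set0]_(i < n.+1) bad n i.
have mBad n : measurable (Bad n) by apply: bigsetU_measurable.
have PBad n : (P (Bad n) <= (r ^+ 2 / n.+1%:R)%:E)%E.
  have n0 : 0 < n.+1%:R :> R by rewrite ltr0n.
  apply: (@le_trans _ _ (\sum_(i < n.+1) P (bad n i))%E).
    exact: Boole_inequality.
  apply: (@le_trans _ _ (\sum_(i < n.+1) ((r / n.+1%:R) ^+ 2)%:E)%E).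
    apply: lee_sum => i _.
    have -> : r / n.+1%:R = r * (i.+1%:R / n.+1%:R - i%:R / n.+1%:R).
      by rewrite -mulrBl -natrB// subSnn mul1r.
    apply: poisson_double_jump; first by rewrite divr_ge0.
    by rewrite ltr_pM2r ?invr_gt0// ltr_nat.
  rewrite sumEFin lee_fin sumr_const card_ord -[leLHS]mulr_natr.
  by rewrite le_eqVlt; apply/orP; left; apply/eqP; field; rewrite gt_eqF.
have mI : measurable (\bigcap_n Bad n) by exact: bigcapT_measurable.
exists (\bigcap_n Bad n); split => //.
  apply/eqP; rewrite eq_le measure_ge0 andbT; apply/lee_addgt0Pr => e e0.
  rewrite add0e; near \oo => n.
  apply: (@le_trans _ _ (P (Bad n))).
    by apply: le_measure; rewrite ?inE//; exact: bigcap_inf.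
  apply: le_trans (PBad n) _; rewrite lee_fin ler_pdivrMr ?ltr0n// -ler_pdivrMl//.
  apply: (@le_trans _ _ n%:R); last by rewrite ler_nat.
  by near: n; exact: nbhs_infty_ger.
move=> w /= nex n _; apply: contrapT => nBad; apply: nex; exists n.+1 => // i ni.
have : ~ bad n i w.
  by move=> b; apply: nBad; rewrite /Bad -bigcup_mkord; exists i.
rewrite /bad => /contrapT[/= ->|/= ->]; first by rewrite addn0.
by rewrite addn1.
Unshelve. all: by end_near. Qed.

End poisson_paths.

(** * Almost sure paths of a compound Poisson process *)

Section counting_path.
Variables (R : realType) (f : R -> nat).

Lemma cadlag_nat_right_const t : cadlag (fun t => (f t)%:R : R) -> 0 <= t ->
  exists2 e, 0 < e & forall u : R, t <= u < t + e -> f u = f t.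
Proof.
move=> cf t0; have [frc _] := cf t t0.
have := @cvgr_dist_lt _ _ _ _ _ _ _ frc 1 ltr01.
rewrite near_withinE => -[e /= e0 be]; exists e => // u /andP[tu ute].
have [->//|ut] := eqVneq u t.
have : `|(f t)%:R - (f u)%:R| < 1 :> R.
  apply: be; last by rewrite lt_neqAle eq_sym ut.
  by rewrite /= distrC ger0_norm ?subr_ge0// ltrBlDl.
case: (ltngtP (f t) (f u)) => // h.
- rewrite distrC ger0_norm ?subr_ge0 ?ler_nat 1?ltnW//.
  by rewrite ltrBlDl natr1 ltr_nat ltnS leqNgt h.
- rewrite ger0_norm ?subr_ge0 ?ler_nat 1?ltnW//.
  by rewrite ltrBlDl natr1 ltr_nat ltnS leqNgt h.
Qed.

Hypothesis f_cadlag : cadlag (fun t => (f t)%:R : R).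
Hypothesis f_rat_nd : forall p q : rat, 0 <= ratr p :> R -> ratr p < ratr q :> R ->
  (f (ratr p) <= f (ratr q))%N.

(** By right continuity the values at [s] and [t] are also taken at rational times
    just after [s] and [t]. *)
Lemma cadlag_nat_nd s t : 0 <= s -> s <= t -> (f s <= f t)%N.
Proof.
move=> s0; rewrite le_eqVlt => /predU1P[->//|st].
have t0 : 0 <= t by exact: le_trans (ltW st).
have [e e0 fe] := cadlag_nat_right_const f_cadlag s0.
have [e' e'0 fe'] := cadlag_nat_right_const f_cadlag t0.
have [p] : exists p, ratr p \in `]s, Num.min (s + e) t[.
  by apply: rat_in_itvoo; rewrite lt_min ltrDl e0.
rewrite in_itv/= lt_min => /and3P[sp pe pt].
have [q] : exists q, ratr q \in `]t, (t + e')[.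
  by apply: rat_in_itvoo; rewrite ltrDl.
rewrite in_itv/= => /andP[tq qe].
rewrite -(fe (ratr p)) ?(ltW sp)// -(fe' (ratr q)) ?(ltW tq)//.
apply: f_rat_nd; first by rewrite (le_trans s0) ?ltW.
exact: lt_trans tq.
Qed.

Hypothesis f_grid : exists2 n, (0 < n)%N &
  forall i, (i < n)%N -> (f (i.+1%:R / n%:R) <= (f (i%:R / n%:R)).+1)%N.

(** [t] is the left end of the grid cell that contains [s]. *)
Lemma grid_unit_jumps (s : R) : 0 < s <= 1 ->
  exists2 t, 0 <= t < s & (f s <= (f t).+1)%N.
Proof.
move=> /andP[s0 s1]; have [n n0 fn] := f_grid.
have n0' : 0 < n%:R :> R by rewrite ltr0n.
have exi : exists i, s <= i.+1%:R / n%:R.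
  by exists n.-1; rewrite prednK// divff// gt_eqF.
pose i := ex_minn exi.
have [si imin] : s <= i.+1%:R / n%:R /\ forall j, s <= j.+1%:R / n%:R -> (i <= j)%N.
  by rewrite /i; case: ex_minnP.
have i_n : (i < n)%N.
  by rewrite -(prednK n0) ltnS imin// prednK// divff// gt_eqF.
exists (i%:R / n%:R).
  rewrite divr_ge0//=; case: (i) imin => [|j] jmin; first by rewrite mul0r.
  by rewrite ltNge; apply/negP => /jmin; rewrite ltnn.
apply: leq_trans (fn i i_n); apply: cadlag_nat_nd => //; exact: ltW.
Qed.

End counting_path.

Section compound_poisson_path.
Context {disp} {T : measurableType disp} {R : realType} (P : probability T R).
Variables (r : R) (N : R -> {RV P >-> nat}).
Hypothesis r0 : 0 < r.
Hypothesis Npois : poisson_process r N.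

Lemma poisson_rat_nd_ae : {ae P, forall w, forall p q : rat,
  0 <= ratr p :> R -> ratr p < ratr q :> R ->
  (N (ratr p) w <= N (ratr q) w)%N}.
Proof.
have : {ae P, forall w, forall n : nat,
    if unpickle n is Some (p, q) then 0 <= ratr (p : rat) :> R ->
      ratr p < ratr (q : rat) :> R -> (N (ratr p) w <= N (ratr q) w)%N
    else True}.
  apply: ae_foralln => n; case: unpickle => [[p q]|]; last exact: aeW.
  have [p0|p0] := boolP (0 <= ratr p :> R); last by apply: aeW => w.
  have [pq|pq] := boolP (ratr p < ratr q :> R); last by apply: aeW => w.
  by apply: filterS (poisson_nd_ae r0 Npois p0 pq).
by apply: filterS => w h p q; have := h (pickle (p, q)); rewrite pickleK.
Qed.

(** Outside a null set the path of [N] starts at 0, is nondecreasing and right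
    continuous and has unit jumps; then [discrete_qv_unit_jumps] applies. *)
Lemma discrete_qv_compound_poisson_ae d (Y : nat -> T -> 'cV[R]_d)
    (L : R -> T -> 'cV[R]_d) :
  {ae P, forall w, forall t, 0 <= t -> L t w = \sum_(k < N t w) Y k w} ->
  {ae P, forall w, discrete_qv (fun t => L t w) 1 =
                   \sum_(k < N 1 w) Y k w *m (Y k w)^T}.
Proof.
have [N0 _ _ Ncad] := Npois => LY.
have gridN := poisson_unit_grid_ae r0 Npois.
have ratN := poisson_rat_nd_ae.
near=> w.
have f0 : N 0 w = 0%N by near: w.
have cad : cadlag (fun t => (N t w)%:R : R) by near: w.
have grid : exists2 n, (0 < n)%N & forall i, (i < n)%N ->
   (N (i.+1%:R / n%:R) w <= (N (i%:R / n%:R) w).+1)%N by near: w.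
have rat_nd : forall p q : rat, 0 <= ratr p :> R -> ratr p < ratr q :> R ->
  (N (ratr p) w <= N (ratr q) w)%N by near: w.
apply: (@discrete_qv_unit_jumps _ _ (fun t => N t w) (fun k => Y k w)) => //.
- by move=> s t s0 st; exact: (@cadlag_nat_nd _ (fun t => N t w)).
- by move=> t t0; exact: (@cadlag_nat_right_const _ (fun t => N t w)).
- by move=> s s01; exact: (@grid_unit_jumps _ (fun t => N t w)).
- by near: w.
Unshelve. all: by end_near. Qed.

Lemma poisson_marginal t k : 0 < t ->
  P [set w | N t w = k] = (poisson_pmf (r * t) k)%:E.
Proof.
move=> t0; have [N0 _ Npmf _] := Npois.
rewrite -{2}[t]subr0 -Npmf//.
have mN s (B : set nat) : measurable (N s @^-1` B).
  by rewrite -[X in measurable X]setTI; exact: (measurable_funPT (N s)).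
have [Z [mZ PZ NZ]] := N0.
have N0w w : (~` Z) w -> N 0 w = 0%N by move=> Zw; apply: contrapT => /NZ.
set A := [set w | N t w = k]; set B := [set w | _ = _].
have mA : measurable A by exact: (mN t [set k]).
have mB : measurable B.
  rewrite (_ : B = \bigcup_j (N 0 @^-1` [set j] `&` N t @^-1` [set (j + k)%N])).
    by apply: bigcupT_measurable => j; apply: measurableI; exact: mN.
  apply/seteqP; split=> w.
    rewrite /B /= => /eqP; rewrite subr_eq -natrD eqr_nat addnC => /eqP Nt.
    by exists (N 0 w).
  by move=> [j _ [/= Ns Nt]]; rewrite /B /= Ns Nt natrD addrAC subrr add0r.
have PU C : measurable C -> P C = P (C `|` Z).
  by move=> mC; rewrite measureU0.
rewrite (PU A)// (PU B)//; congr (P _); apply/seteqP.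
split=> w [h|]; [|by right|move: h|by right].
- have [|Zw] := pselect (Z w); first by right.
  by left; rewrite /B /= h N0w// subr0.
- have [|Zw] := pselect (Z w); first by right.
  rewrite /B /= N0w// subr0 => /eqP; rewrite eqr_nat => /eqP; by left.
Qed.

End compound_poisson_path.

(** * Sums with a Poisson number of terms *)

Section poisson_random_index.
Context {disp} {T : measurableType disp} {R : realType} (P : probability T R).
Variables (r : R) (M : {RV P >-> nat}) (G : set (set T)).
Hypothesis r0 : 0 < r.
Hypothesis M_poisson : forall n, P [set w | M w = n] = (poisson_pmf r n)%:E.
Hypothesis mG : G `<=` measurable.
Hypothesis MG : independent_systems P (preimage_set_system setT M measurable) G.
Implicit Types (f F : nat -> T -> R).

Let E n := [set w | M w = n].

Let mE n : measurable (E n).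
Proof.
by rewrite -[E n]setTI; exact: (measurable_funPT M measurableT [set n]).
Qed.

Let p := poisson_pmf r.

Let has_mean_on f n c : adapted G (f n) -> has_mean P (f n) c ->
  (\int[P]_(x in E n) (f (M x) x)%:E = (p n * c)%:E)%E.
Proof.
move=> af fc; rewrite integral_mkcond.
have [_ <-] : has_mean P (fun x => \1_(E n) x * f n x) (p n * c).
  apply: (has_meanM _ mG MG _ _ fc af).
  - exact: preimage_system_measurable.
  - by have := has_mean_indic P (mE n); rewrite M_poisson.
  - have : measurable_fun setT (fun k : nat => (k == n)%:R : R) by [].
    move/(adapted_preimage M); congr (adapted _ _).
    apply/funext => w; rewrite /= indicE.
    by case: eqVneq => [h|/eqP h]; [rewrite mem_set|rewrite memNset].
apply: eq_integral => x _; rewrite patchE indicE.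
by case: ifPn => [/set_mem/= -> |]; rewrite ?mul1r ?mul0r.
Qed.

Let cover : \bigcup_n E n = setT.
Proof. by apply/seteqP; split=> // w _; exists (M w). Qed.

Let trivE : trivIset setT E.
Proof.
apply/trivIsetP => i j _ _ ij; apply/seteqP; split=> // w [Mi Mj].
by move: ij; rewrite -Mi -Mj eqxx.
Qed.

Let measurable_random_index f : (forall n, adapted G (f n)) ->
  measurable_fun setT (fun w => f (M w) w).
Proof.
move=> af _ B mB; rewrite setTI.
rewrite (_ : _ @^-1` B = \bigcup_n (E n `&` f n @^-1` B)).
  by apply: bigcupT_measurable => n; apply: measurableI => //; apply: mG; exact: af.
apply/seteqP; split=> [w fB|w [n _ [/= <-]]//].
by exists (M w).
Qed.

Let series_mean (A B : R) : (\sum_(n <oo)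
    (p n * (A * n%:R + B * (n%:R * (n%:R - 1))))%:E = (A * r + B * r ^+ 2)%:E)%E.
Proof.
apply/cvg_lim => //; rewrite (_ : (fun n => _) = EFin \o
    series (fun n => p n * (A * n%:R + B * (n%:R * (n%:R - 1))))).
  by apply: cvg_EFin; [exact: nearW|exact: cvg_series_poisson_moments].
by apply/funext => n; rewrite /= sumEFin.
Qed.

(** Conditionally on [M = n] the mean is that of [f n], by independence, and the
    factorial moments [r] and [r ^ 2] of [M] replace [n] and [n (n - 1)].  The
    dominating family [F] makes the sum over [n] absolutely convergent. *)
Lemma has_mean_random_index f F (A B A' B' : R) :
  (forall n, adapted G (f n)) -> (forall n, adapted G (F n)) ->
  (forall n w, `|f n w| <= F n w) ->
  (forall n, has_mean P (f n) (A * n%:R + B * (n%:R * (n%:R - 1)))) ->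
  (forall n, has_mean P (F n) (A' * n%:R + B' * (n%:R * (n%:R - 1)))) ->
  has_mean P (fun w => f (M w) w) (A * r + B * r ^+ 2).
Proof.
move=> af aF fF fA FA.
have F0 n w : 0 <= F n w by exact: le_trans (fF n w).
have mf := measurable_random_index af; have mF := measurable_random_index aF.
have [Fi _] : has_mean P (fun w => F (M w) w) (A' * r + B' * r ^+ 2).
  apply: has_mean_ge0 => //.
  rewrite -[X in integral _ X _]cover ge0_integral_bigcup//; last 2 first.
  - by rewrite cover; exact/measurable_EFinP.
  - by move=> w _; rewrite lee_fin.
  by rewrite -series_mean; apply: eq_eseriesr => n _; exact: has_mean_on.
have fi : P.-integrable setT (EFin \o (fun w => f (M w) w)).
  apply: le_integrable Fi => //; first exact/measurable_EFinP.
  by move=> w _; rewrite /= lee_fin (le_trans (fF _ _))// ler_norm.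
split=> //; rewrite -[X in integral _ X _]cover integral_bigcup//; last first.
  by rewrite cover.
by rewrite -series_mean; apply: eq_eseriesr => n _; exact: has_mean_on.
Qed.

End poisson_random_index.

Section uncorrelated_sums.
Context {disp} {T : measurableType disp} {R : realType} (P : probability T R).
Variables a b : nat -> T -> R.

Lemma has_mean_sum_const n alpha : (forall k, has_mean P (a k) alpha) ->
  has_mean P (fun w => \sum_(k < n) a k w) (alpha * n%:R).
Proof.
move=> aalpha; rewrite (_ : alpha * _ = \sum_(k < n) alpha).
  by apply: has_mean_sum => k _; exact: aalpha.
by rewrite sumr_const card_ord mulr_natr.
Qed.

(** There are [n] diagonal and [n (n - 1)] off-diagonal products. *)
Lemma has_mean_mul_sums n gamma delta :
  (forall k l, has_mean P (fun w => a k w * b l w) (if k == l then gamma else delta)) ->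
  has_mean P (fun w => (\sum_(k < n) a k w) * (\sum_(l < n) b l w))
    (gamma * n%:R + delta * (n%:R * (n%:R - 1))).
Proof.
move=> ab.
rewrite (_ : (fun w => _) = fun w => \sum_(k < n) \sum_(l < n) a k w * b l w).
  rewrite (_ : _ + _ = \sum_(k < n) \sum_(l < n) if k == l :> nat then gamma else delta).
    by do 2 (apply: has_mean_sum => ? _); exact: ab.
  have row (k : 'I_n) : \sum_(l < n) (if k == l :> nat then gamma else delta) =
      gamma + delta * (n%:R - 1).
    rewrite (eq_bigr (fun l : 'I_n => delta + (gamma - delta) * (k == l)%:R)).
      by rewrite big_split/= -mulr_sumr sumr_const card_ord (bigD1 k)//= eqxx big1;
        [rewrite addr0 mulr1 -mulr_natr; ring|move=> l; rewrite eq_sym => /negPf ->].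
    move=> l _; rewrite -val_eqE /=; case: eqVneq => _.
      by rewrite mulr1 addrC subrK.
    by rewrite mulr0 addr0.
  under eq_bigr do rewrite row.
  by rewrite sumr_const card_ord -mulr_natr; ring.
by apply/funext => w; rewrite big_distrlr.
Qed.

End uncorrelated_sums.

(** * Moments of compound Poisson sums *)

Section compound_poisson_moments.
Context {disp e : measure_display} {T : measurableType disp}.
Context {S : measurableType e} {R : realType} (P : probability T R).
Variables (r : R) (M : {RV P >-> nat}) (Y : nat -> {RV P >-> S}).
Hypothesis r0 : 0 < r.
Hypothesis M_poisson : forall n, P [set w | M w = n] = (poisson_pmf r n)%:E.
Hypothesis Y_law : forall k A, measurable A -> P (Y k @^-1` A) = P (Y 0%N @^-1` A).
Hypothesis Y_indep :
  mutually_independent_systems P (fun k => preimage_set_system setT (Y k) measurable).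
Hypothesis MY_indep : independent_systems P (preimage_set_system setT M measurable)
  (sigma_family [set: nat] Y).

Let mY k : measurable_fun setT (Y k). Proof. exact: measurable_funPT. Qed.

Let GY := \bigcup_(k in [set: nat]) preimage_set_system setT (Y k) measurable.

Let mG : sigma_family [set: nat] Y `<=` measurable.
Proof.
apply: smallest_sub; first exact: sigma_algebra_measurable.
by move=> _ [k _ [B mB <-]]; exact: mY.
Qed.

Let adapted_sum n (u : nat -> S -> R) : (forall k, measurable_fun setT (u k)) ->
  measurable_fun setT ((fun w => \sum_(k < n) u k (Y k w)) : g_sigma_algebraType GY -> R).
Proof.
move=> mu; apply: measurable_sum => k.
have mYk : measurable_fun setT (Y k : g_sigma_algebraType GY -> S).
  by move=> _ B mB; apply: sub_sigma_algebra; exists (val k) => //; exists B.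
exact: measurableT_comp (mu k) mYk.
Qed.

Let adaptedG (f : T -> R) :
  measurable_fun setT (f : g_sigma_algebraType GY -> R) ->
  adapted (sigma_family [set: nat] Y) f.
Proof. by move=> mf B mB; have := mf measurableT B mB; rewrite setTI. Qed.

Let law_mean (h : S -> R) k c : measurable_fun setT h ->
  has_mean P (h \o Y 0%N) c -> has_mean P (h \o Y k) c.
Proof. by move=> mh; apply: has_mean_transfer => //; exact: Y_law. Qed.

Let pair_mean (h1 h2 : S -> R) a b c k l :
  measurable_fun setT h1 -> measurable_fun setT h2 ->
  has_mean P (h1 \o Y 0%N) a -> has_mean P (h2 \o Y 0%N) b ->
  has_mean P (fun w => h1 (Y 0%N w) * h2 (Y 0%N w)) c ->
  has_mean P (fun w => h1 (Y k w) * h2 (Y l w)) (if k == l then c else a * b).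
Proof.
move=> mh1 mh2 h1a h2b h12c; case: eqVneq => [<-|kl].
  by apply: (@law_mean (fun y => h1 y * h2 y)) => //; exact: measurable_funM.
have := @has_mean_prod _ _ _ P nat _ _ Y_indep [:: k; l]
  (fun i => if i == k then h1 \o Y k else h2 \o Y l)
  (fun i => if i == k then a else b).
rewrite !big_cons big_nil mulr1 eqxx eq_sym (negPf kl).
rewrite (_ : (fun x => _) = (fun w => h1 (Y k w) * h2 (Y l w))); last first.
  by apply/funext => w; rewrite !big_cons big_nil mulr1 eqxx eq_sym (negPf kl).
apply.
- by move=> i A [B mB <-]; exact: mY.
- by rewrite /= inE kl.
- move=> i; rewrite !inE; case: eqVneq => [-> _|_ /= /eqP ->].
    by split; [exact: law_mean|exact: adapted_preimage].
  by split; [exact: law_mean|exact: adapted_preimage].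
Qed.

Lemma has_mean_compound_sum (h : S -> R) a : measurable_fun setT h ->
  has_mean P (h \o Y 0%N) a ->
  has_mean P (fun w => \sum_(k < M w) h (Y k w)) (a * r).
Proof.
move=> mh ha.
have mnh : measurable_fun setT (fun y => `|h y|) by exact: measurableT_comp.
have hna := has_mean_norm ha; set a' := fine _ in hna.
have E c n : c * n%:R = c * n%:R + 0 * (n%:R * (n%:R - 1)) :> R.
  by rewrite mul0r addr0.
rewrite (_ : a * r = a * r + 0 * r ^+ 2); last by rewrite mul0r addr0.
apply: (@has_mean_random_index _ _ _ P r M _ r0 M_poisson mG MY_indep
  (fun n w => \sum_(k < n) h (Y k w)) (fun n w => \sum_(k < n) `|h (Y k w)|)
  a 0 a' 0).
- by move=> n; apply: adaptedG; exact: (@adapted_sum n (fun=> h)).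
- by move=> n; apply: adaptedG; exact: (@adapted_sum n (fun=> fun y => `|h y|)).
- by move=> n w; exact: ler_norm_sum.
- move=> n; rewrite -E; apply: (@has_mean_sum_const _ _ _ P (fun k w => h (Y k w))).
  by move=> k; exact: law_mean.
- move=> n; rewrite -E; apply: (@has_mean_sum_const _ _ _ P (fun k w => `|h (Y k w)|)).
  by move=> k; exact: (@law_mean (fun y => `|h y|)).
Qed.

(** The absolute values of the summands satisfy the same hypotheses, so the product
    of their sums can serve as the dominating family. *)
Lemma has_mean_compound_mul (h1 h2 : S -> R) a b c :
  measurable_fun setT h1 -> measurable_fun setT h2 ->
  has_mean P (h1 \o Y 0%N) a -> has_mean P (h2 \o Y 0%N) b ->
  has_mean P (fun w => h1 (Y 0%N w) * h2 (Y 0%N w)) c ->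
  has_mean P (fun w => (\sum_(k < M w) h1 (Y k w)) * (\sum_(k < M w) h2 (Y k w)))
    (c * r + a * b * r ^+ 2).
Proof.
move=> mh1 mh2 h1a h2b h12c.
have mnh1 : measurable_fun setT (fun y => `|h1 y|) by exact: measurableT_comp.
have mnh2 : measurable_fun setT (fun y => `|h2 y|) by exact: measurableT_comp.
have nh1 := has_mean_norm h1a; set a' := fine _ in nh1.
have nh2 := has_mean_norm h2b; set b' := fine _ in nh2.
have nh12 := has_mean_norm h12c; set c' := fine _ in nh12.
have nh12' : has_mean P (fun w => `|h1 (Y 0%N w)| * `|h2 (Y 0%N w)|) c'.
  rewrite (_ : (fun w => _) = (fun w => `|h1 (Y 0%N w) * h2 (Y 0%N w)|))//.
  by apply/funext => w; rewrite normrM.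
have madp (u1 u2 : S -> R) n : measurable_fun setT u1 -> measurable_fun setT u2 ->
    adapted (sigma_family [set: nat] Y)
      (fun w => (\sum_(k < n) u1 (Y k w)) * (\sum_(k < n) u2 (Y k w))).
  move=> mu1 mu2; apply: adaptedG; apply: measurable_funM.
    exact: (@adapted_sum n (fun=> u1)).
  exact: (@adapted_sum n (fun=> u2)).
apply: (@has_mean_random_index _ _ _ P r M _ r0 M_poisson mG MY_indep
  (fun n w => (\sum_(k < n) h1 (Y k w)) * (\sum_(k < n) h2 (Y k w)))
  (fun n w => (\sum_(k < n) `|h1 (Y k w)|) * (\sum_(k < n) `|h2 (Y k w)|))
  c (a * b) c' (a' * b')).
- by move=> n; exact: madp.
- by move=> n; exact: (madp (fun y => `|h1 y|) (fun y => `|h2 y|)).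
- by move=> n w; rewrite normrM ler_pM// ler_norm_sum.
- move=> n; apply: (@has_mean_mul_sums _ _ _ P (fun k w => h1 (Y k w))
    (fun k w => h2 (Y k w))).
  by move=> k l; exact: pair_mean.
- move=> n; apply: (@has_mean_mul_sums _ _ _ P (fun k w => `|h1 (Y k w)|)
    (fun k w => `|h2 (Y k w)|)).
  by move=> k l; exact: (@pair_mean (fun y => `|h1 y|) (fun y => `|h2 y|)).
Qed.

(** The square of [r] in the mean of the product cancels against the product of the
    means. *)
Lemma has_mean_compound_cov (h1 h2 : S -> R) a b c :
  measurable_fun setT h1 -> measurable_fun setT h2 ->
  has_mean P (h1 \o Y 0%N) a -> has_mean P (h2 \o Y 0%N) b ->
  has_mean P (fun w => h1 (Y 0%N w) * h2 (Y 0%N w)) c ->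
  has_mean P (fun w => (\sum_(k < M w) h1 (Y k w) - a * r) *
                       (\sum_(k < M w) h2 (Y k w) - b * r)) (c * r).
Proof.
move=> mh1 mh2 h1a h2b h12c.
have m1 := has_mean_compound_sum mh1 h1a.
have m2 := has_mean_compound_sum mh2 h2b.
have m12 := has_mean_compound_mul mh1 mh2 h1a h2b h12c.
have := has_meanD (has_meanD m12 (has_meanZ (- (b * r)) m1))
  (has_meanD (has_meanZ (- (a * r)) m2) (has_mean_cst P (a * r * (b * r)))).
congr (has_mean P _ _); last by ring.
by apply/funext => w /=; ring.
Qed.

End compound_poisson_moments.

(** * Moments of one jump *)

Section mixture_moments.
Context {disp} {T : measurableType disp} {R : realType} (P : probability T R).
Variables (n : nat) (C : 'M[R]_n) (eps : {RV P >-> R}) (X : {RV P >-> 'cV[R]_n}).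
Hypothesis C_psd : psdmx C.
Hypothesis eps_ge0 : forall w, 0 <= eps w.
Hypothesis eps_var : ('V_P[eps] < +oo)%E.
Hypothesis X_normal : standard_normal_vector X.
Hypothesis eps_X_indep : independent_systems P (g_sigma_algebra_preimage eps)
                                          (g_sigma_algebra_preimage X).

Let meps : measurable_fun setT eps. Proof. exact: measurable_funPT. Qed.

(** [eps ^ 2 <= 2 (eps - m) ^ 2 + 2 m ^ 2] holds for any [m], in particular for the
    value that centres the variance when the mean is infinite; so a finite
    variance does give a finite second moment. *)
Lemma has_mean_finite_variance :
  has_mean P eps (fine 'E_P[eps]) /\
  has_mean P (fun w => eps w ^+ 2) (fine 'E_P[(fun w => eps w ^+ 2)%R]).
Proof.
pose m := fine 'E_P[eps].
have i2 : P.-integrable setT (EFin \o (fun w => (eps w - m) ^+ 2)).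
  apply/integrableP; split.
    apply/measurable_EFinP; apply: measurable_funX; exact: measurable_funB.
  move: eps_var; rewrite /variance !unlock.
  apply: le_lt_trans; rewrite le_eqVlt; apply/orP; left; apply/eqP.
  apply: eq_integral => w _ /=; rewrite ger0_norm ?sqr_ge0// expr2.
  by rewrite /m unlock.
have [bi _] : has_mean P (fun w => 2 * (eps w - m) ^+ 2 + 2 * m ^+ 2)
    (2 * fine 'E_P[(fun w => (eps w - m) ^+ 2)%R] + 2 * m ^+ 2).
  apply: has_meanD; last exact: has_mean_cst.
  by apply: has_meanZ; exact: has_mean_fine.
have m2 : measurable_fun setT (fun w => eps w ^+ 2) by exact: measurable_funX.
have e2i : P.-integrable setT (EFin \o (fun w => eps w ^+ 2)).
  apply: le_integrable bi => //; first exact/measurable_EFinP.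
  move=> w _; rewrite /= lee_fin ger0_norm ?sqr_ge0//.
  (* the difference of the two sides is a square *)
  by apply: le_trans (ler_norm _); have := sqr_ge0 (eps w - 2 * m); nra.
split; apply: has_mean_fine => //.
have [ci _] := has_meanD (has_mean_cst P 1) (has_mean_fine e2i).
apply: le_integrable ci => //; first exact/measurable_EFinP.
move=> w _; rewrite /= lee_fin ger0_norm// ger0_norm ?addr_ge0 ?sqr_ge0//.
by have := sqr_ge0 (eps w - 1); have := eps_ge0 w; nra.
Qed.

Let Z w := psdsqrtmx (eps w *: C) *m X w.
Let W w := psdsqrtmx C *m X w.

Let ZE w i : Z w i 0 = Num.sqrt (eps w) * W w i 0.
Proof. by rewrite /Z psdsqrtmxZ// -scalemxAl mxE. Qed.

Let Z2E w i j : Z w i 0 * Z w j 0 = eps w * (W w i 0 * W w j 0).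
Proof.
rewrite !ZE mulrACA -expr2 sqr_sqrtr//.
Qed.

Let mX i : measurable_fun setT (fun x : 'cV[R]_n => (psdsqrtmx C *m x) i 0).
Proof.
under eq_fun do rewrite mxE.
apply: measurable_sum => j; apply: measurable_funM => //.
exact: measurable_coord.
Qed.

Lemma measurable_mixture : measurable_fun setT Z.
Proof.
apply: measurable_fun_mx => i j; rewrite ord1.
rewrite (_ : (fun x => _) = (fun w => Num.sqrt (eps w) * W w i 0)); last first.
  by apply/funext => w; rewrite ZE.
apply: measurable_funM.
  apply: measurableT_comp meps.
  by apply: continuous_measurable_fun; exact: sqrt_continuous.
by have := measurableT_comp (mX i) (measurable_funPT X).
Qed.

Let sqrtC : psdsqrtmx C *m (psdsqrtmx C)^T = C.
Proof. by have [[-> _]] := psdsqrtmxP C_psd. Qed.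

Let mul_eps (u : R -> R) (h : 'cV[R]_n -> R) a c :
  measurable_fun setT u -> measurable_fun setT h ->
  has_mean P (u \o eps) a -> has_mean P (h \o X) c ->
  has_mean P (fun w => u (eps w) * h (X w)) (a * c).
Proof.
move=> mu mh ua hc; apply: (has_meanM _ _ eps_X_indep ua _ hc).
- exact: preimage_system_measurable.
- exact: preimage_system_measurable.
- exact: adapted_preimage.
- exact: adapted_preimage.
Qed.

Lemma has_mean_mixture2 i j :
  has_mean P (fun w => Z w i 0 * Z w j 0) (fine 'E_P[eps] * C i j).
Proof.
have [e1 _] := has_mean_finite_variance.
rewrite (_ : (fun w => _) = (fun w => eps w * (W w i 0 * W w j 0))); last first.
  by apply/funext => w; rewrite Z2E.
apply: (@mul_eps idfun (fun x => (psdsqrtmx C *m x) i 0 * (psdsqrtmx C *m x) j 0)).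
- exact: measurable_id.
- exact: measurable_funM.
- exact: e1.
- by have := has_mean_linear2 X_normal (psdsqrtmx C) i j; rewrite sqrtC.
Qed.

Lemma has_mean_mixture4 i j k l :
  has_mean P (fun w => (Z w i 0 * Z w j 0) * (Z w k 0 * Z w l 0))
   (fine 'E_P[(fun w => eps w ^+ 2)%R] *
     (C i j * C k l + C i k * C j l + C i l * C j k)).
Proof.
have [_ e2] := has_mean_finite_variance.
rewrite (_ : (fun w => _) = (fun w => eps w ^+ 2 *
    ((W w i 0 * W w j 0) * (W w k 0 * W w l 0)))); last first.
  by apply/funext => w; rewrite !Z2E; ring.
apply: (@mul_eps (fun x => x ^+ 2) (fun x =>
  ((psdsqrtmx C *m x) i 0 * (psdsqrtmx C *m x) j 0) *
  ((psdsqrtmx C *m x) k 0 * (psdsqrtmx C *m x) l 0))).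
- exact: measurable_funX.
- by apply: measurable_funM; exact: measurable_funM.
- exact: e2.
- by have := has_mean_linear4 X_normal (psdsqrtmx C) i j k l; rewrite sqrtC.
Qed.

End mixture_moments.

(** * Expectation and covariance of the discrete quadratic variation *)

Theorem proposition5p4 (R : realType) (d : nat)
    (disp disp' : measure_display)
    (T : measurableType disp) (P : probability T R)
    (T' : measurableType disp') (P' : probability T' R)
    (r : R) (C : 'M[R]_d)
    (eps : {RV P' >-> R}) (X : {RV P' >-> 'cV[R]_d})
    (L : R -> {RV P >-> 'cV[R]_d})
    (r_gt0 : 0 < r)
    (C_psd : psdmx C)
    (eps_ge0 : forall w, 0 <= eps w)
    (eps_var : ('V_P'[eps] < +oo)%E)
    (X_normal : standard_normal_vector X)
    (eps_X_indep : independent_systems P' (g_sigma_algebra_preimage eps)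
                                          (g_sigma_algebra_preimage X))
    (L_cpp : compound_poisson_process r
      (pushforward P' (fun w => psdsqrtmx (eps w *: C) *m X w)) L) :
  expectation_mx P (fun w => discrete_qv (fun t => L t w) 1)
    = map_mx EFin ((r * fine 'E_P'[eps]%E) *: C)
  /\
  covariance_mx P (fun w => vec (discrete_qv (fun t => L t w) 1))
    = map_mx EFin ((r * fine 'E_P'[(fun w => eps w ^+ 2)%R]%E) *:
        (C *t C + commutation_mx R d *m (C *t C) + vec C *m (vec C)^T)).
Proof.
have [N [Y [Npois Ylaw Yindep NYindep LY]]] := L_cpp.
pose Z w := psdsqrtmx (eps w *: C) *m X w.
have mZ : measurable_fun setT Z by exact: measurable_mixture.
have YZ k A : measurable A -> P (Y k @^-1` A) = P' (Z @^-1` A) by exact: Ylaw.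
have YY k A : measurable A -> P (Y k @^-1` A) = P (Y 0%N @^-1` A).
  by move=> mA; rewrite !YZ.
have Y0mean h c : measurable_fun setT h -> has_mean P' (h \o Z) c ->
    has_mean P (h \o Y 0%N) c.
  by move=> mh; apply: has_mean_transfer => //; exact: YZ.
have M_poisson n : P [set w | N 1 w = n] = (poisson_pmf r n)%:E.
  by rewrite (poisson_marginal Npois)// mulr1.
have MY : independent_systems P (preimage_set_system setT (N 1) measurable)
    (sigma_family [set: nat] Y).
  move=> A B NA YB; apply: NYindep => //; apply: sub_sigma_algebra.
  by exists 1; rewrite /=.
pose h i j (y : 'cV[R]_d) : R := y i 0 * y j 0.
have mh i j : measurable_fun setT (h i j).
  by apply: measurable_funM; exact: measurable_coord.
have hmean i j : has_mean P (h i j \o Y 0%N) (fine 'E_P'[eps] * C i j).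
  by apply: Y0mean => //; exact: has_mean_mixture2.
pose Q i j w : R := \sum_(k < N 1 w) h i j (Y k w).
have qvQ : {ae P, forall w, forall i j,
    discrete_qv (fun t => L t w) 1 i j = Q i j w}.
  have := @discrete_qv_compound_poisson_ae _ _ _ _ r N r_gt0 Npois d Y L LY.
  apply: filterS => w -> i j.
  rewrite summxE; apply: eq_bigr => k _.
  by rewrite mxE big_ord1 mxE.
have Qmean i j : has_mean P (Q i j) (fine 'E_P'[eps] * C i j * r).
  exact: (has_mean_compound_sum r_gt0 M_poisson YY MY (mh i j) (hmean i j)).
pose qv i j w := discrete_qv (fun t => L t w) 1 i j.
have Eqv i j : ('E_P[qv i j])%E = (fine 'E_P'[eps] * C i j * r)%:E.
  by apply: expectation_ae_eq (Qmean i j); move: qvQ; apply: filterS => w wQ;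
    exact: wQ.
have covqv i j k l : covariance P (qv i j) (qv k l) =
    (fine 'E_P'[(fun w => eps w ^+ 2)%R] *
     (C i j * C k l + C i k * C j l + C i l * C j k) * r)%:E.
  have m4 : has_mean P (fun w => h i j (Y 0%N w) * h k l (Y 0%N w))
     (fine 'E_P'[(fun w => eps w ^+ 2)%R] *
       (C i j * C k l + C i k * C j l + C i l * C j k)).
    apply: (@Y0mean (fun y => h i j y * h k l y)); first exact: measurable_funM.
    exact: has_mean_mixture4.
  have cm := has_mean_compound_cov r_gt0 M_poisson YY Yindep MY (mh i j) (mh k l)
    (hmean i j) (hmean k l) m4.
  rewrite unlock (Eqv i j) (Eqv k l); apply: expectation_ae_eq cm.
  by move: qvQ; apply: filterS => w wQ; rewrite /= -/(Q i j w) -/(Q k l w) -!wQ.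
split; apply/matrixP => i j; rewrite !mxE.
  by rewrite Eqv; congr EFin; ring.
case: (mxtens_indexP i) => i1 i2; case: (mxtens_indexP j) => j1 j2.
have vecE w (k l : 'I_d) : vec (discrete_qv (fun t => L t w) 1)
    (mxtens_index (k, l)) 0 = qv l k w.
  by rewrite mxE mxtens_indexK.
under eq_fun do rewrite vecE; under [X in covariance _ _ X]eq_fun do rewrite vecE.
rewrite -/(qv i2 i1) -/(qv j2 j1) covqv big_ord1 !mxtens_indexK/=.
have -> : \sum_k commutation_mx R d (mxtens_index (i1, i2)) k *
    (C *t C) k (mxtens_index (j1, j2)) = C i2 j1 * C i1 j2.
  rewrite (bigD1 (mxtens_index (i2, i1)))//= !mxE !mxtens_indexK eqxx mul1r.
  rewrite big1 ?addr0// => k; case: (mxtens_indexP k) => k1 k2 kN.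
  rewrite !mxE !mxtens_indexK/= (_ : _ == _ = false) ?mul0r//.
  by apply: contraNF kN => /eqP[-> ->].
by rewrite !mxE !mxtens_indexK/=; congr EFin; ring.
Qed.
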